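(* Consider the rested multiarmed bandit model with $K$ arms and $M$ plays per slot described in the context, and assume Condition 1 holds. Let UCB-M be run with exploration constant $$L \geq \frac{112\, S^2_{\max}\, r^2_{\max}\, \hat{\pi}^2_{\max}}{\epsilon_{\min}}.$$ Then there is a constant $C_{\mathbf{S,P,r}}$, depending only on the state spaces, the rewards and the transition matrices of the arms (and not on $n$), such that for every horizon $n$ the regret of UCB-M satisfies $$R(n) \leq 4L\ln n \sum_{i>M} \frac{\mu^{1}-\mu^i}{(\mu^{M}-\mu^i)^2} + \sum_{i>M} (\mu^{1}-\mu^i) \Big(M + \sum_{j=1}^M C_{i,j} \Big) + C_{\mathbf{S,P,r}},$$ where $C_{i,j} =\frac{(|S^i|+|S^{j}|)\beta} {\pi_{\min}}$.
   Context: Model: There are $K$ arms indexed by $i\in\{1,\dots,K\}$. Arm $i$ is a discrete-time, irreducible, aperiodic Markov chain on a finite state space $S^i$ with transition matrix $P^i=(p^i_{xy})_{x,y\in S^i}$ and stationary distribution $\pi^i=(\pi^i_x)_{x\in S^i}$; each state $x\in S^i$ carries a reward $r^i_x$. The arms are mutually independent. Time is slotted, $t=1,2,\dots$; in each slot the player selects a set $A(t)$ of exactly $M$ arms ($1\le M\le K$), observes the current states of the selected arms and collects the sum of their rewards. In the rested model, the state of an arm makes one transition according to $P^i$ each time it is played and remains frozen when it is not played. The mean reward of arm $i$ is $\mu^i=\sum_{x\in S^i} r^i_x\pi^i_x$, and arms are indexed so that $\mu^1\ge\mu^2\ge\dots\ge\mu^M>\mu^{M+1}\ge\dots\ge\mu^K$;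 arms $1,\dots,M$ are optimal and arms $M+1,\dots,K$ suboptimal. The regret of a policy up to time $n$ is $R(n)=n\sum_{j=1}^M\mu^j-E\big[\sum_{t=1}^n\sum_{i\in A(t)} r^i_{x^i(t)}\big]$, where $x^i(t)$ is the state of arm $i$ observed when it is played in slot $t$. Condition 1: all arms are finite-state, irreducible, aperiodic Markov chains, $r^i_x>0$ for all $i$ and $x\in S^i$, and for each $i$ the multiplicative symmetrization $\hat P^i=(P^i)'P^i$ is irreducible, where $(P^i)'$ is the adjoint of $P^i$ on $l_2(\pi^i)$, with entries $(p^i)'_{xy}=\pi^i_y p^i_{yx}/\pi^i_x$. Constants: $\epsilon^i=1-\lambda_2(\hat P^i)$ where $\lambda_2$ denotes the second largest eigenvalue; $\epsilon_{\min}=\min_i\epsilon^i$; $\pi^i_{\min}=\min_{x\in S^i}\pi^i_x$; $\pi_{\min}=\min_i\pi^i_{\min}$; $r_{\max}=\max_{i,x} r^i_x$; $S_{\max}=\max_i|S^i|$; $\hat\pi_{\max}=\max_{i,x\in S^i}\max\{\pi^i_x,1-\pi^i_x\}$; $\beta=\sum_{t=1}^\infty t^{-2}$. UCB-M with exploration constant $L>0$: in the first $K$ slots every arm is played exactly $M$ times ($M$ distinct arms per slot). Let $T^i(t)$ be the number of times arm $i$ has been played up to the end of slot $t$ and $\bar r^i(T^i(t))$ the sample mean of the rewards obtained in those plays. For each $t\ge K$, compute for every arm the index $g^i_{t,T^i(t)}=\bar r^i(T^i(t))+\sqrt{L\ln t/T^i(t)}$, and in slot $t+1$ play the $M$ arms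 with the highest indices. *)

(* Defs.v *)
From HB Require Import structures.
From mathcomp Require Import all_boot all_order all_algebra.
From mathcomp Require Import all_classical all_reals all_analysis.
Set Implicit Arguments. Unset Strict Implicit. Unset Printing Implicit Defensive.
Import Order.TTheory GRing.Theory Num.Theory.
Import numFieldNormedType.Exports.
Local Open Scope ring_scope.

Section Markov.
Variables (R : realType) (m : nat).
Implicit Types (A : 'M[R]_m.+1) (p : 'I_m.+1 -> R).

Definition stochastic A :=
  (forall x y, 0 <= A x y) /\ (forall x, \sum_y A x y = 1).

Definition prob_vec p := (forall x, 0 <= p x) /\ \sum_x p x = 1.

Definition irreducible A := forall x y, exists k : nat, 0 < (A ^+ k) x y.

Definition aperiodic A := forall x (d : nat),
  (forall k : nat, (0 < k)%N -> 0 < (A ^+ k) x x -> (d %| k)%N) -> d = 1%N.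

Definition stationary A p :=
  prob_vec p /\ forall y, \sum_x p x * A x y = p y.

(* adjoint of A on l_2(p): A'_{xy} = p_y A_{yx} / p_x *)
Definition adjoint A p : 'M[R]_m.+1 := \matrix_(x, y) (p y * A y x / p x).

Definition msym A p : 'M[R]_m.+1 := adjoint A p *m A.

(* l is the second largest eigenvalue of A (eigenvalues counted with
   multiplicity, all real; convention: 0 if there is only one eigenvalue) *)
Definition is_lambda2 A (l : R) := exists rs : seq R,
  [/\ sorted (fun a b => b <= a) rs,
      char_poly A = \prod_(z <- rs) ('X - z%:P) & rs`_1 = l].

End Markov.

(* minimum over a finite type, well defined when the type is nonempty *)
Definition fmin (R : realType) (I : finType) (F : I -> R) : R :=
  let d := \big[Num.max/0]_i F i in \big[Num.min/d]_i F i.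

Definition beta (R : realType) : R :=
  limn (series (fun k : nat => 1 / (k.+1)%:R ^+ 2 : R)).

Lemma armM_proof (K M : nat) : (0 < M)%N -> (M <= K)%N -> (M.-1 < K)%N.
Proof. by move=> hM hMK; rewrite prednK. Qed.

Lemma arm1_proof (K M : nat) : (0 < M)%N -> (M <= K)%N -> (0 < K)%N.
Proof. by move=> hM hMK; apply: leq_trans hMK. Qed.

(* arm 1 and arm M of the paper (0-based indices 0 and M-1) *)
Definition arm1 K M (hM : (0 < M)%N) (hMK : (M <= K)%N) : 'I_K :=
  Ordinal (arm1_proof hM hMK).
Definition armM K M (hM : (0 < M)%N) (hMK : (M <= K)%N) : 'I_K :=
  Ordinal (armM_proof hM hMK).

Unset Implicit Arguments.
Section Bandit.
Variables (R : realType) (K : nat) (nS : 'I_K -> nat).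
(* arm i has state space 'I_(nS i).+1, i.e. |S^i| = (nS i).+1 *)
Variable r : forall i : 'I_K, 'I_(nS i).+1 -> R.

Definition mu (pi : forall i : 'I_K, 'I_(nS i).+1 -> R) (i : 'I_K) : R :=
  \sum_(x : 'I_(nS i).+1) r i x * pi i x.

Definition Smax : R := (\max_(i < K) (nS i).+1)%:R.
Definition rmax : R := \big[Num.max/0]_i \big[Num.max/0]_(x : 'I_(nS i).+1) r i x.
Definition pihat_max (pi : forall i : 'I_K, 'I_(nS i).+1 -> R) : R :=
  \big[Num.max/0]_i \big[Num.max/0]_(x : 'I_(nS i).+1) Num.max (pi i x) (1 - pi i x).
Definition pi_min (pi : forall i : 'I_K, 'I_(nS i).+1 -> R) : R :=
  fmin (fun i => fmin (pi i)).

Definition Cij (pi : forall i : 'I_K, 'I_(nS i).+1 -> R) (i j : 'I_K) : R :=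
  ((nS i).+1 + (nS j).+1)%:R * beta R / pi_min pi.

(* initialization schedule for slots 1..K: sched t is the set played in slot
   t+1 (t < K); M distinct arms per slot, every arm exactly M times *)
Definition valid_sched (M : nat) (sched : nat -> {set 'I_K}) :=
  (forall t : nat, (t < K)%N -> #|sched t| = M) /\
  (forall i : 'I_K, #|[set t : 'I_K | i \in sched t]| = M).

Definition valid_tb (M : nat) (tb : nat -> ('I_K -> R) -> {set 'I_K}) :=
  forall (t : nat) (g : 'I_K -> R),
    #|tb t g| = M /\
    (forall i j, i \in tb t g -> j \notin tb t g -> g j <= g i).

Variables (L : R) (sched : nat -> {set 'I_K})
          (tb : nat -> ('I_K -> R) -> {set 'I_K}) (n : nat).

(* a sample path: w i k = state of arm i observed at its (k+1)-th play *)
Definition path_space :=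
  {dffun forall i : 'I_K, {ffun 'I_n.+1 -> 'I_(nS i).+1}}.

Implicit Type w : path_space.

Definition sample_mean w (i : 'I_K) (k : nat) : R :=
  (\sum_(j < k) r i (w i (inord j))) / k%:R.

Definition ucb_index w (t : nat) (T : 'I_K -> nat) (i : 'I_K) : R :=
  sample_mean w i (T i) + Num.sqrt (L * ln (t%:R) / (T i)%:R).

(* arms played in slot t+1, given the play counts T after slot t *)
Definition play w (t : nat) (T : 'I_K -> nat) : {set 'I_K} :=
  if (t < K)%N then sched t else tb t (ucb_index w t T).

Fixpoint counts w (t : nat) : 'I_K -> nat :=
  match t with
  | 0 => fun _ => 0%N
  | t'.+1 => fun i => (counts w t' i + (i \in play w t' (counts w t')))%N
  end.

Definition slot_reward w (t : nat) : R :=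
  \sum_(i in play w t (counts w t)) r i (w i (inord (counts w t i))).

Definition total_reward w : R := \sum_(t < n) slot_reward w t.

(* probability of a sample path: independent arms, each a Markov chain with
   transition matrix P i started from the distribution init i (rested model:
   the state moves one step per play) *)
Definition path_prob (P : forall i : 'I_K, 'M[R]_((nS i).+1))
  (init : forall i : 'I_K, 'I_(nS i).+1 -> R) w : R :=
  \prod_(i < K) (init i (w i ord0) *
     \prod_(k < n) P i (w i (inord k)) (w i (inord k.+1))).

Definition expected_reward P init : R :=
  \sum_(w : path_space) path_prob P init w * total_reward w.

Definition regret P init (pi : forall i : 'I_K, 'I_(nS i).+1 -> R) (M : nat) : R :=
  n%:R * (\sum_(j < K | (j < M)%N) mu pi j) - expected_reward P init.

End Bandit.

Arguments mu {R K nS} r pi i.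
Arguments Smax {R K} nS.
Arguments rmax {R K nS} r.
Arguments pihat_max {R K nS} pi.
Arguments pi_min {R K nS} pi.
Arguments Cij {R K nS} pi i j.
Arguments valid_sched {K} M sched.
Arguments valid_tb {R K} M tb.
Arguments regret {R K nS} r L sched tb n P init pi M.

(* Main.v *)
Require Import Defs.
From HB Require Import structures.
From mathcomp Require Import all_boot all_order all_algebra.
From mathcomp Require Import all_classical all_reals all_analysis.
From mathcomp Require Import complex ring lra zify.
Import Order.TTheory GRing.Theory Num.Theory.
Local Open Scope ring_scope.
Set Implicit Arguments. Unset Strict Implicit. Unset Printing Implicit Defensive.

(** For each arm let [g] solve the Poisson equation [g - P g = r - mu].  The
    number of plays of an arm up to time [n] is a stopping time for its chain,
    so the expected centred reward of the arm telescopes to a difference of two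
    values of [g], and the regret is at most the sum over suboptimal arms of
    [(mu_1 - mu_i) E[T_i(n)]] plus a constant depending on the arms only.

    A suboptimal arm that has been played more than
    [4 L ln n / (mu_M - mu_i)^2] times is selected only if its sample mean, or
    that of some optimal arm, deviates by the confidence width
    [sqrt (L ln t / s)].  On mean-zero functions [P] contracts [l_2(pi)] with
    squared factor at most [1 - eps]; perturbing [P] by [exp (theta f)] gives a
    Chernoff bound [exp (- s gamma^2 eps / (32 r_max^2))] for such a deviation.
    The hypothesis on [L] makes it at most [const / t^3], since
    [S_max pihat_max >= 1]; a union bound over the number of plays [s <= t] and
    a sum over [t] leave a constant, which goes into [C]. *)

(** * Spectral gap of a symmetric matrix with a simple fixed vector *)

Lemma char_poly_conj (R : comUnitRingType) n (A B U : 'M[R]_n) :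
  U \in unitmx -> A = invmx U *m B *m U -> char_poly A = char_poly B.
Proof.
move=> Uu ->; rewrite /char_poly.
have -> : char_poly_mx (invmx U *m B *m U) =
    map_mx polyC (invmx U) *m char_poly_mx B *m map_mx polyC U.
  rewrite /char_poly_mx mulmxBr mulmxBl -!map_mxM; congr (_ - _).
  rewrite mul_mx_scalar -scalemxAl -map_mxM mulVmx // map_mx1.
  by rewrite scalemx1.
rewrite !det_mulmx mulrAC -det_mulmx -map_mxM mulVmx // map_mx1 det1 mul1r //.
Qed.

Lemma char_poly_diag (R : comNzRingType) n (d : 'rV[R]_n) :
  char_poly (diag_mx d) = \prod_(z <- [seq d 0 i | i : 'I_n]) ('X - z%:P).
Proof.
rewrite char_poly_trig ?diag_mx_is_trig // big_map big_enum /=.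
by apply: eq_bigr => i _; rewrite mxE eqxx.
Qed.

Lemma path_ge_head (R : numDomainType) (z : R) s :
  path (fun a b => b <= a) z s -> forall w, w \in s -> w <= z.
Proof.
have tr : transitive (fun a b : R => b <= a).
  by move=> x y w h1 h2; exact: le_trans h2 h1.
by move=> /(order_path_min tr)/allP.
Qed.

Section SymmetricGap.
Variables (R : rcfType) (n : nat).
Local Notation toC := (real_complex R).
Local Notation "M ^cx" := (map_mx toC M) (at level 1, format "M ^cx").
Local Notation "M ^adj" := (map_mx Num.conj M^T) (at level 1, format "M ^adj").

Lemma conj_toC (x : R) : Num.conj (toC x) = toC x.
Proof. by apply/CrealP; rewrite complex_real. Qed.

Lemma toC_adj p q (A : 'M[R]_(p, q)) : (A^cx)^adj = (A^T)^cx.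
Proof. by apply/matrixP => i j; rewrite !mxE conj_toC. Qed.

(** Kernels commute with the embedding of [R] into [R[i]], so passing to complex scalars creates no
    new fixed directions. *)
Lemma toC_submx_fixed (S : 'M[R]_n) (v : 'rV[R]_n) :
  (forall u : 'rV_n, u *m S = u -> exists c, u = c *: v) ->
  forall u : 'rV[R[i]]_n, u *m S^cx = u -> (u <= v^cx)%MS.
Proof.
move=> hv u uS.
have sub : (kermx (S - 1%:M) <= v)%MS.
  apply/rV_subP => x /sub_kermxP; rewrite mulmxBr mulmx1 => /subr0_eq /hv[c ->].
  exact: scalemx_sub.
apply: submx_trans (_ : (map_mx toC (kermx (S - 1%:M)) <= _)%MS); last first.
  by rewrite map_submx.
rewrite map_kermx; apply/sub_kermxP.
by rewrite map_mxB map_mx1 mulmxBr mulmx1 uS subrr.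
Qed.

(* Over R[i] the matrix is unitarily diagonalizable; simplicity of the
   eigenvalue 1 leaves exactly one diagonal entry equal to 1, on the v-axis. *)
Lemma symmetric_gap (S : 'M[R]_n) (v : 'rV[R]_n) (rs : seq R) :
  S^T = S -> v != 0 -> v *m S = v ->
  (forall u : 'rV_n, u *m S = u -> exists c, u = c *: v) ->
  char_poly S = \prod_(z <- rs) ('X - z%:P) ->
  sorted (fun a b => b <= a) rs -> (forall z, z \in rs -> z <= 1) ->
  rs`_1 < 1 /\
  forall f : 'rV_n, f *m v^T = 0 ->
    (f *m S *m f^T) 0 0 <= rs`_1 * (f *m f^T) 0 0.
Proof.
move=> symS v0 vS fixS chS srs rs1.
pose U := spectralmx S^cx; pose d := spectral_diag S^cx.
have Uu : U \is unitarymx := spectral_unitarymx _.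
have UUh : U *m U^adj = 1%:M by apply/unitarymxP.
have Uinv : invmx U = U^adj by rewrite invmx_unitary.
have UhU : U^adj *m U = 1%:M.
  by rewrite -Uinv mulVmx // unitarymx_unit.
have Sdef : S^cx = invmx U *m diag_mx d *m U.
  apply/orthomx_spectralP/normalmxP.
  by rewrite toC_adj symS.
have perm_d : perm_eq [seq d 0 i | i : 'I_n] [seq toC z | z <- rs].
  apply: prod_XsubC_eq; rewrite -char_poly_diag.
  rewrite -(char_poly_conj (unitarymx_unit Uu) Sdef) -map_char_poly chS.
  rewrite rmorph_prod /= !big_map; apply: eq_bigr => z _.
  by rewrite rmorphB /= map_polyX map_polyC.
have SUh : S^cx *m U^adj = U^adj *m diag_mx d.
  by rewrite Sdef -[LHS]mulmxA UUh mulmx1 Uinv.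
have US : U *m S^cx = diag_mx d *m U.
  by rewrite Sdef Uinv !mulmxA UUh mul1mx.
(* Coordinates of [v] in the eigenbasis. As [v] is fixed, they vanish wherever the diagonal entry
   differs from 1; as [v] is nonzero, some entry [d 0 i0] equals 1. *)
pose a := v^cx *m U^adj.
have ad i : a 0 i * d 0 i = a 0 i.
  have : a *m diag_mx d = a by rewrite /a -mulmxA -SUh mulmxA -map_mxM vS.
  by move/rowP/(_ i); rewrite mul_mx_diag !mxE.
have vC0 : v^cx != 0 by rewrite map_mx_eq0.
have /rV0Pn[i0 ai0] : a != 0.
  apply: contraNneq vC0 => a0.
  by rewrite -[v^cx]mulmx1 -UhU mulmxA -/a a0 mul0mx.
have di0 : d 0 i0 = 1.
  by apply: (mulfI ai0); rewrite ad mulr1.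
have rowv i : d 0 i = 1 -> exists c, row i U = c *: v^cx.
  move=> di1; apply/sub_rVP/(toC_submx_fixed fixS).
  rewrite -row_mul US; apply/rowP => j; rewrite mul_diag_mx !mxE di1.
  by rewrite mul1r.
(* Two rows of [U] with eigenvalue 1 would both be multiples of [v], although distinct rows are
   orthogonal and of norm 1. *)
have uniq1 i : i != i0 -> d 0 i != 1.
  move=> ii0; apply/eqP => /rowv[c hc]; have [c0 hc0] := rowv _ di0.
  have dotU j k : (row j U *m (row k U)^adj) 0 0 = (j == k)%:R.
    by move/row_unitarymxP: Uu => /(_ j k); rewrite dotmxE.
  have := dotU i i0; have := dotU i i; have := dotU i0 i0.
  rewrite !eqxx (negPf ii0) hc hc0.
  have E x y : (x *: v^cx *m (y *: v^cx)^adj) 0 0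
      = x * Num.conj y * (v^cx *m (v^cx)^adj) 0 0.
    by rewrite linearZ /= map_mxZ -scalemxAl -scalemxAr scalerA mxE.
  rewrite !E => /eqP h1 /eqP h2 /eqP; rewrite !mulf_eq0 conjC_eq0.
  case/orP=> [/orP[]|] /eqP h.
  - by move: h2; rewrite h !mul0r eq_sym oner_eq0.
  - by move: h1; rewrite h !mul0r eq_sym oner_eq0.
  - by move: h1; rewrite h !mulr0 eq_sym oner_eq0.
have one_rs : 1 \in rs.
  have : d 0 i0 \in [seq toC z | z <- rs].
    by rewrite -(perm_mem perm_d); apply/mapP; exists i0; rewrite ?mem_enum.
  by rewrite di0 => /mapP[z zrs /complexI ->].
(* The head of [rs] is 1, because [rs] is sorted, bounded by 1 and contains 1. Cancelling it against
   [i0] matches the other eigenvalues with the tail of [rs]. *)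
have perm_d' : perm_eq [seq d 0 i | i <- rem i0 (enum 'I_n)]
                       [seq toC z | z <- behead rs].
  case E : rs srs rs1 one_rs => [//|z rs'] /= srs rs1 one_rs.
  have z1 : z = 1.
    apply/eqP; rewrite eq_le rs1 ?mem_head //=.
    by move: one_rs; rewrite inE => /orP[/eqP <- //|/(path_ge_head srs)].
  move: perm_d; rewrite E /= z1 -(perm_cons (toC 1)).
  have h := perm_map (fun i => d 0 i) (perm_to_rem (mem_enum 'I_n i0)).
  by rewrite perm_cons (permPl h) /= di0 perm_cons.
have lead_rs w : w \in behead rs -> w <= rs`_1.
  case: (rs) srs => [|z [|y s]] //= /andP[_ sy].
  by rewrite inE => /orP[/eqP -> //|/(path_ge_head sy)].
have mem_rem i : (i \in rem i0 (enum 'I_n)) = (i != i0).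
  by rewrite mem_rem_uniq ?enum_uniq // !inE mem_enum andbT.
have d_rs i : i != i0 -> exists2 w, d 0 i = toC w & w <= rs`_1.
  move=> ii0.
  have : d 0 i \in [seq toC z | z <- behead rs].
    by rewrite -(perm_mem perm_d'); apply/map_f; rewrite mem_rem.
  by move=> /mapP[w /lead_rs wle ->]; exists w.
split.
  (* If [rs] has no second entry, [nth] returns its default 0, which is below 1. Otherwise that
     entry is an eigenvalue at an index other than [i0]. *)
  have [|] := boolP (rs`_1 \in behead rs); last first.
    by case: (rs) => [|z [|y s]] //=; rewrite ?ltr01 // mem_head.
  move=> h.
  have [j] : exists2 i, i \in rem i0 (enum 'I_n) & toC rs`_1 = d 0 i.
    by apply/mapP; rewrite (perm_mem perm_d'); apply/map_f.
  rewrite mem_rem => /uniq1 dj1 E.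
  rewrite lt_neqAle (rs1 _ (mem_behead h)) andbT.
  by apply: contraNneq dj1; rewrite -E => ->.
move=> f fv.
pose b := f^cx *m U^adj.
have bh : b^adj = U *m (f^T)^cx.
  by rewrite /b trmx_mul map_mxM /= toC_adj trmxCK.
have ah : a^adj = U *m (v^T)^cx.
  by rewrite /a trmx_mul map_mxM /= toC_adj trmxCK.
(* Orthogonality to [v] kills the one coordinate whose eigenvalue, 1, lies above the second entry of
   [rs]. *)
have bi0 : b 0 i0 = 0.
  have : (b *m a^adj) 0 0 = 0.
    by rewrite ah /b mulmxA -(mulmxA f^cx) UhU mulmx1 -map_mxM fv map_mx0 mxE.
  rewrite mxE (bigD1 i0) //= big1 => [|i ii0].
    move/eqP; rewrite addr0 !mxE mulf_eq0 => /orP[/eqP //|].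
    by rewrite conjC_eq0 => /eqP h; move: ai0; rewrite /a mxE h eqxx.
  have -> : a^adj i 0 = 0.
    rewrite !mxE; apply/eqP; rewrite conjC_eq0; apply/eqP.
    have /eqP := ad i; rewrite -subr_eq0 -[X in _ - X]mulr1 -mulrBr mulf_eq0.
    by rewrite subr_eq0 (negPf (uniq1 _ ii0)) orbF /a mxE => /eqP.
  by rewrite mulr0.
rewrite -lecR rmorphM /=.
have -> : toC ((f *m S *m f^T) 0 0) = \sum_i d 0 i * (b 0 i * Num.conj (b 0 i)).
  transitivity ((f^cx *m S^cx *m (f^T)^cx) 0 0); first by rewrite -!map_mxM [RHS]mxE.
  rewrite Sdef Uinv !mulmxA -/b -mulmxA -bh mxE.
  apply: eq_bigr => i _; rewrite mul_mx_diag !mxE.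
  by rewrite -mulrA mulrCA.
have -> : toC ((f *m f^T) 0 0) = \sum_i (b 0 i * Num.conj (b 0 i)).
  transitivity ((f^cx *m (f^T)^cx) 0 0); first by rewrite -!map_mxM [RHS]mxE.
  rewrite -[f^cx]mulmx1 -UhU mulmxA -/b -mulmxA -bh mxE.
  by apply: eq_bigr => i _; rewrite !mxE.
rewrite mulr_sumr; apply: ler_sum => i _.
have [->|ii0] := eqVneq i i0; first by rewrite bi0 mul0r !mulr0.
have [w -> wle] := d_rs _ ii0.
by rewrite ler_wpM2r ?mul_conjC_ge0 // lecR.
Qed.
End SymmetricGap.

(** * Finite Markov chains *)

Section Stochastic.
Variables (R : realType) (m : nat).
Implicit Types (A P : 'M[R]_m.+1) (p f g h : 'I_m.+1 -> R).

Definition mact A f x := \sum_y A x y * f y.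

Lemma mact_mulmx A B f x : mact (A *m B) f x = mact A (mact B f) x.
Proof.
rewrite /mact; under eq_bigr do rewrite mxE mulr_suml.
rewrite exchange_big /=; apply: eq_bigr => z _; rewrite mulr_sumr.
by apply: eq_bigr => y _; rewrite mulrA.
Qed.

Lemma mact_cst A c x : stochastic A -> mact A (fun=> c) x = c.
Proof. by case=> _ A1; rewrite /mact -mulr_suml A1 mul1r. Qed.

Lemma mactD A f g x : mact A (fun y => f y + g y) x = mact A f x + mact A g x.
Proof. by rewrite /mact -big_split; apply: eq_bigr => y _; rewrite mulrDr. Qed.

Lemma stochastic_mulmx A B : stochastic A -> stochastic B -> stochastic (A *m B).
Proof.
move=> [A0 A1] hB; split=> [x y|x].
  by rewrite mxE sumr_ge0 // => z _; rewrite mulr_ge0 // hB.1.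
transitivity (mact (A *m B) (fun=> 1) x).
  by apply: eq_bigr => y _; rewrite mulr1.
rewrite mact_mulmx -[RHS](A1 x); apply: eq_bigr => y _.
by rewrite mact_cst // mulr1.
Qed.

Lemma stochastic_expmx A k : stochastic A -> stochastic (A ^+ k).
Proof.
move=> hA; elim: k => [|k IH]; last by rewrite exprS; apply: stochastic_mulmx.
split=> [x y|x]; first by rewrite mxE ler0n.
by rewrite (bigD1 x) //= mxE eqxx big1 ?addr0 // => y; rewrite mxE eq_sym => /negPf ->.
Qed.

Lemma stationary_expmx P p k : stationary P p ->
  forall y, \sum_x p x * (P ^+ k) x y = p y.
Proof.
move=> [_ hp]; elim: k => [|k IH] y.
  rewrite (bigD1 y) //= mxE eqxx mulr1 big1 ?addr0 // => x.
  by rewrite mxE => /negPf ->; rewrite mulr0.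
rewrite exprSr; under eq_bigr do rewrite mxE mulr_sumr.
rewrite exchange_big /= -[RHS]hp; apply: eq_bigr => z _.
by rewrite -[in RHS]IH mulr_suml; apply: eq_bigr => x _; rewrite mulrA.
Qed.

(** Some state carries positive mass; a positive entry of a power of [P] carries it to any other
    state. *)
Lemma stationary_gt0 P p : stochastic P -> irreducible P -> stationary P p ->
  forall x, 0 < p x.
Proof.
move=> hP irr hp y; have [[p0 p1] _] := hp.
have [x px] : exists x, 0 < p x.
  apply: contrapT => /forallNP h; suff : \sum_x p x <= 0 by rewrite p1 ler10.
  by apply: sumr_le0 => x _; rewrite leNgt; apply/negP/h.
have [k hk] := irr x y; rewrite -(stationary_expmx k hp).
rewrite (bigD1 x) //= ltr_pwDl ?mulr_gt0 // sumr_ge0 // => z _.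
by rewrite mulr_ge0 // (stochastic_expmx k hP).1.
Qed.

Lemma mact_expmx A f k : mact A f =1 f -> mact (A ^+ k) f =1 f.
Proof.
move=> hf; elim: k => [|k IH] x.
  rewrite /mact (bigD1 x) //= mxE eqxx mul1r big1 ?addr0 // => y.
  by rewrite mxE eq_sym => /negPf ->; rewrite mul0r.
rewrite exprSr mact_mulmx -[RHS]IH; apply: eq_bigr => y _.
by rewrite hf.
Qed.

(** Maximum principle: at a maximiser [x0], the nonnegative differences [f x0 - f z] average to zero
    under every power of [A], so [f] takes its maximum at each state reachable from [x0]. *)
Lemma irreducible_fixed_cst A f : stochastic A -> irreducible A ->
  mact A f =1 f -> forall x y, f x = f y.
Proof.
move=> hA irr hf.
pose x0 := [arg max_(x > (ord0 : 'I_m.+1)) f x]%O.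
have f0 y : f y <= f x0.
  by rewrite /x0; case: Order.TotalTheory.arg_maxP => // i _ h; apply: h.
suff h y : f y = f x0 by move=> x y; rewrite !h.
have [k hk] := irr x0 y.
have hAk := stochastic_expmx k hA.
have : \sum_z (A ^+ k) x0 z * (f x0 - f z) = 0.
  under eq_bigr do rewrite mulrBr.
  by rewrite sumrB -mulr_suml hAk.2 mul1r [X in _ - X](mact_expmx k hf) subrr.
move/eqP; rewrite psumr_eq0 => [|z _]; last by rewrite mulr_ge0 ?subr_ge0 // hAk.1.
move=> /allP /(_ y); rewrite mem_index_enum => /(_ isT) /=.
by rewrite mulf_eq0 gt_eqF //= subr_eq0 => /eqP.
Qed.

(** The difference of the two sides is the variance of [f] under row [x] of [P]. *)
Lemma mact_sqr_le P f x : stochastic P ->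
  mact P f x ^+ 2 <= mact P (fun y => f y ^+ 2) x.
Proof.
move=> hP; rewrite -subr_ge0; set c := mact P f x.
have -> : mact P (fun y => f y ^+ 2) x - c ^+ 2 =
    \sum_y P x y * (f y - c) ^+ 2.
  under [RHS]eq_bigr do rewrite sqrrB mulrDr mulrBr.
  rewrite big_split sumrB /= -[X in _ = _ - _ + X]mulr_suml hP.2 mul1r.
  have -> : \sum_i P x i * (f i * c *+ 2) = c * c *+ 2.
    by rewrite {2}/c /mact mulr_suml -sumrMnl; apply: eq_bigr => y _; ring.
  by rewrite /mact; ring.
by apply: sumr_ge0 => y _; rewrite mulr_ge0 ?sqr_ge0 // hP.1.
Qed.

Lemma mean_mact P p f : stationary P p ->
  \sum_x p x * mact P f x = \sum_x p x * f x.
Proof.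
move=> [_ hp]; rewrite /mact; under eq_bigr do rewrite mulr_sumr.
rewrite exchange_big /=; apply: eq_bigr => y _.
by rewrite -[in RHS]hp mulr_suml; apply: eq_bigr => x _; rewrite mulrA.
Qed.

Lemma mact_contraction P p f : stochastic P -> stationary P p ->
  \sum_x p x * mact P f x ^+ 2 <= \sum_x p x * f x ^+ 2.
Proof.
move=> hP hp; rewrite -[leRHS](mean_mact _ hp); apply: ler_sum => x _.
by rewrite ler_wpM2l ?mact_sqr_le // hp.1.1.
Qed.

Lemma stochastic_msym P p : stochastic P -> stationary P p ->
  (forall x, 0 < p x) -> stochastic (msym P p).
Proof.
move=> hP [_ hp] p0; apply: stochastic_mulmx => //; split=> [x y|x].
  by rewrite mxE divr_ge0 ?mulr_ge0 ?(ltW (p0 _)) // hP.1.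
under eq_bigr do rewrite mxE.
by rewrite -mulr_suml hp divff // gt_eqF.
Qed.

(** Conjugation by the diagonal matrix [D] of square roots of [p] turns [P] into [B] and [msym P p]
    into the symmetric [S]. The quadratic form of [S] at [s x * f x] is the squared [l_2(p)] norm of
    [P f], and mean zero becomes orthogonality to [v], so [symmetric_gap] applies. *)
Lemma msym_gap P p (e : R) : stochastic P -> stationary P p ->
  (forall x, 0 < p x) -> irreducible (msym P p) ->
  is_lambda2 (msym P p) (1 - e) ->
  [/\ 0 < e, e <= 1 & forall f, \sum_x p x * f x = 0 ->
    \sum_x p x * mact P f x ^+ 2 <= (1 - e) * \sum_x p x * f x ^+ 2].
Proof.
move=> hP hp p0 irr [rs [srs chS rse]].
pose s x := Num.sqrt (p x).
have s0 x : 0 < s x by rewrite sqrtr_gt0.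
have sn0 x : s x != 0 by rewrite gt_eqF.
have ss x : s x * s x = p x by rewrite -expr2 sqr_sqrtr // ltW.
pose v : 'rV[R]_m.+1 := \row_x s x.
pose D := diag_mx v.
pose B : 'M[R]_m.+1 := \matrix_(z, y) (s z * P z y / s y).
pose S := B^T *m B.
have Du : D \in unitmx.
  rewrite unitmxE unitfE det_diag; apply/prodf_neq0 => x _; by rewrite mxE.
have DS : D *m msym P p = S *m D.
  apply/matrixP => x y; rewrite mul_diag_mx mul_mx_diag !mxE mulr_suml mulr_sumr.
  apply: eq_bigr => z _; rewrite !mxE -!ss; field.
  by rewrite !sn0.
have simS : msym P p = invmx D *m S *m D by rewrite -mulmxA -DS mulKmx.
have Bv : B *m v^T = v^T.
  apply/colP => z; rewrite !mxE.
  under eq_bigr do rewrite !mxE divfK //.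
  by rewrite -mulr_sumr hP.2 mulr1.
have vB : v *m B = v.
  apply/rowP => y; rewrite !mxE; under eq_bigr do rewrite !mxE mulrA mulrA ss.
  by rewrite -mulr_suml hp.2 -ss mulfK.
have vS : v *m S = v.
  by rewrite /S mulmxA -[v *m B^T]trmxK trmx_mul trmxK Bv trmxK.
have quadS f : let phi := \row_x (s x * f x) in
    (phi *m S *m phi^T) 0 0 = \sum_x p x * mact P f x ^+ 2.
  move=> phi; rewrite /S mulmxA -[_ *m B *m _]mulmxA -[phi *m B^T]trmxK trmx_mul trmxK.
  rewrite mxE; apply: eq_bigr => z _; rewrite mxE -expr2.
  suff -> : (B *m phi^T) z 0 = s z * mact P f z by rewrite exprMn expr2 ss.
  rewrite mxE /mact mulr_sumr; apply: eq_bigr => y _; rewrite !mxE.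
  by rewrite -!mulrA mulKf.
have quad1 f : let phi := \row_x (s x * f x) in
    (phi *m phi^T) 0 0 = \sum_x p x * f x ^+ 2.
  move=> phi; rewrite mxE; apply: eq_bigr => z _.
  by rewrite !mxE -expr2 exprMn expr2 ss.
have rowE (u : 'rV[R]_m.+1) : u = \row_x (s x * (u 0 x / s x)).
  by apply/rowP => x; rewrite !mxE mulrC divfK.
have symS : S^T = S by rewrite /S trmx_mul trmxK.
have chS' : char_poly S = \prod_(z <- rs) ('X - z%:P).
  by rewrite -chS (char_poly_conj Du simS).
(* Each eigenvalue is a Rayleigh quotient of [S]: nonnegative because the form is a squared norm, at
   most 1 because [P] contracts [l_2(p)]. *)
have rs01 z : z \in rs -> 0 <= z <= 1.
  move=> zrs; have /eigenvalueP[u uS u0] : eigenvalue S z.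
    by rewrite eigenvalue_root_char chS' root_prod_XsubC.
  have hq : (u *m S *m u^T) 0 0 = z * (u *m u^T) 0 0.
    by rewrite uS -scalemxAl mxE.
  have : 0 < (u *m u^T) 0 0.
    have /rV0Pn[x ux] := u0; rewrite mxE (bigD1 x) //= mxE -expr2.
    rewrite ltr_pwDl ?exprn_even_gt0 // sumr_ge0 // => y _.
    by rewrite mxE -expr2 sqr_ge0.
  have := mact_contraction (fun x => u 0 x / s x) hP hp.
  rewrite -quadS -quad1 -rowE hq => hle hpos.
  have : 0 <= z * (u *m u^T) 0 0.
    rewrite -hq [u]rowE quadS sumr_ge0 // => x _.
    by rewrite mulr_ge0 ?sqr_ge0 // ltW.
  by rewrite pmulr_lge0 // => ->; rewrite -(ler_pM2r hpos) mul1r.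
have v0 : v != 0.
  by apply/eqP => /rowP/(_ ord0); rewrite !mxE => /eqP; rewrite (negPf (sn0 _)).
(* Divided by [s], a fixed vector of [S] becomes a fixed function of [msym P p], which is constant
   by irreducibility. *)
have fixS (u : 'rV_m.+1) : u *m S = u -> exists c, u = c *: v.
  move=> uS; pose h x := u 0 x / s x.
  have fixh : mact (msym P p) h =1 h.
    move=> x; apply: (mulfI (sn0 x)).
    transitivity ((u *m S) 0 x); last by rewrite uS mulrC divfK.
    have -> : u *m S = (S *m u^T)^T by rewrite trmx_mul trmxK symS.
    rewrite mxE mxE /mact mulr_sumr; apply: eq_bigr => y _.
    have : s x * msym P p x y = S x y * s y.
      have := DS => /matrixP/(_ x y); rewrite mul_diag_mx mul_mx_diag.
      by rewrite mxE [X in _ = X]mxE [v 0 x]mxE [v 0 y]mxE.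
    by rewrite mulrA /h => ->; rewrite [u^T y 0]mxE -mulrA [s y * _]mulrC divfK.
  have hc := irreducible_fixed_cst (stochastic_msym hP hp p0) irr fixh.
  exists (h ord0); apply/rowP => x; rewrite !mxE (hc _ x) /h divfK //.
have [lt1 ray] := symmetric_gap symS v0 vS fixS chS' srs
  (fun z zrs => (andP (rs01 z zrs)).2).
rewrite rse in lt1 ray.
split=> [||f f0]; first by move: lt1; rewrite gtrBl.
  (* The second entry of [rs] is an eigenvalue, hence nonnegative, or the default 0 of a list that
     is too short. *)
  suff : 0 <= 1 - e by rewrite subr_ge0.
  rewrite -rse; case: (ltnP 1 (size rs)) => [/(mem_nth 0)/rs01/andP[]//|h].
  by rewrite nth_default.
rewrite -quadS -quad1; apply: ray.
apply/matrixP => i j; rewrite !ord1 !mxE -[RHS]f0; apply: eq_bigr => x _.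
by rewrite !mxE mulrAC ss.
Qed.

End Stochastic.

(** * Exponential moments *)

(** Since [expR (- x) >= 1 - x], the exponential is at most [1 / (1 - x)]. The quadratic times
    [1 - x] equals [1 + 8/7 x^2 (1/8 - x)], which links the constants [1 / 8] and [8 / 7]. *)
Lemma expR_le_quad (R : realType) (x : R) : `|x| <= 1 / 8 ->
  expR x <= 1 + x + 8 / 7 * x ^+ 2.
Proof.
rewrite ler_norml => /andP[xl xu].
have x1 : 0 < 1 - x by lra.
have : expR x * (1 - x) <= 1.
  rewrite -[leRHS](expRxMexpNx_1 x) ler_wpM2l ?expR_ge0 //.
  exact: expR_ge1Dx.
rewrite -ler_pdivlMr // => /le_trans; apply.
rewrite ler_pdivrMr //.
have : 0 <= x ^+ 2 * (1 / 8 - x) by rewrite mulr_ge0 ?sqr_ge0 //; lra.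
nra.
Qed.

(* AM-GM on the cross term [2 a (q - 1) v] with weight [3 e / 4]. *)
Lemma expR_sqr_bound (R : realType) (x t e a v : R) : 0 < e -> e <= 1 ->
  0 <= t -> t <= e / 8 -> `|x| <= t ->
  expR x * (a + v) ^+ 2 <=
    a ^+ 2 * (1 + x + 4 * (t ^+ 2 / e)) + 2 * a * v + (1 + e) * v ^+ 2.
Proof.
move=> e0 e1 t0 te xt.
have xq := expR_le_quad (le_trans xt (le_trans te _)).
have {}xq : expR x <= 1 + x + 8 / 7 * x ^+ 2 by apply: xq; lra.
have x1 := expR_ge1Dx x.
have x2 : x ^+ 2 <= t ^+ 2.
  by rewrite -[x ^+ 2]real_normK ?num_real // ler_pXn2r // nnegrE.
move: xt; rewrite ler_norml => /andP[xl xu].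
set w := expR x - 1.
have wE : expR x = 1 + w by rewrite /w; ring.
have wu : w <= 8 / 7 * t by rewrite /w; nra.
have wl : - (8 / 7 * t) <= w by rewrite /w; lra.
have w2 : w ^+ 2 <= 64 / 49 * t ^+ 2.
  have : 0 <= (8 / 7 * t - w) * (8 / 7 * t + w) by rewrite mulr_ge0 //; lra.
  lra.
have wx : w <= x + 8 / 7 * t ^+ 2 by rewrite /w; lra.
set c := t ^+ 2 / e.
have tc : t ^+ 2 <= c.
  by rewrite /c ler_pdivlMr // ler_piMr ?sqr_ge0.
have c0 : 0 <= c by rewrite /c divr_ge0 ?sqr_ge0 // ltW.
have cross : 2 * a * (w * v) <= 4 / 3 * (64 / 49 * c) * a ^+ 2 + 3 / 4 * e * v ^+ 2.
  have : 0 <= (a * w * (4 / 3) / e - v) ^+ 2 * (3 / 4 * e).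
    by rewrite mulr_ge0 ?sqr_ge0 //; lra.
  have -> : (a * w * (4 / 3) / e - v) ^+ 2 * (3 / 4 * e) =
     4 / 3 * a ^+ 2 * (w ^+ 2 / e) - 2 * a * (w * v) + 3 / 4 * e * v ^+ 2.
    by field; rewrite gt_eqF.
  have : 4 / 3 * a ^+ 2 * (w ^+ 2 / e) <= 4 / 3 * a ^+ 2 * (64 / 49 * c).
    have a0 : 0 <= 4 / 3 * a ^+ 2 by have := sqr_ge0 a; lra.
    by apply: ler_wpM2l => //; rewrite /c mulrA ler_pM2r // invr_gt0.
  lra.
have h1 : a ^+ 2 * w <= a ^+ 2 * (x + 8 / 7 * c).
  by rewrite ler_wpM2l ?sqr_ge0 //; lra.
have h2 : w * v ^+ 2 <= e / 7 * v ^+ 2.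
  by rewrite ler_wpM2r ?sqr_ge0 //; lra.
have h3 : 0 <= a ^+ 2 * c by rewrite mulr_ge0 ?sqr_ge0.
have h4 : 0 <= e * v ^+ 2 by rewrite mulr_ge0 ?sqr_ge0 // ltW.
(* The coefficients of [a ^+ 2 * c] add up to [256/147 + 8/7 < 4], those of [e * v ^+ 2] to
   [3/4 + 1/7 < 1]. *)
rewrite wE; lra.
Qed.

(** * Poisson equation and tilted operators for a chain with a spectral gap *)

Section ChainGap.
Variables (R : realType) (m : nat) (P : 'M[R]_m.+1) (p : 'I_m.+1 -> R) (e : R).
Hypotheses (hP : stochastic P) (hp : stationary P p) (p0 : forall x, 0 < p x).
Hypotheses (e0 : 0 < e) (e1 : e <= 1).
Hypothesis gap : forall f, \sum_x p x * f x = 0 ->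
  \sum_x p x * mact P f x ^+ 2 <= (1 - e) * \sum_x p x * f x ^+ 2.
Implicit Types (f g h u : 'I_m.+1 -> R).

Lemma gap_fixed0 f : \sum_x p x * f x = 0 -> mact P f =1 f -> f =1 (fun=> 0).
Proof.
move=> f0 hf; have := gap f0.
under eq_bigr do rewrite hf.
rewrite mulrBl mul1r lerBrDr -lerBrDl subrr pmulr_rle0 // => h x.
have : \sum_x p x * f x ^+ 2 == 0.
  rewrite eq_le h sumr_ge0 // => y _.
  by rewrite mulr_ge0 ?sqr_ge0 // ltW.
rewrite psumr_eq0 => [|y _]; last by rewrite mulr_ge0 ?sqr_ge0 // ltW.
move=> /allP /(_ x); rewrite mem_index_enum => /(_ isT) /=.
by rewrite mulf_eq0 gt_eqF //= sqrf_eq0 => /eqP.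
Qed.

(* [1 - P] is inverted on mean-zero functions through the invertible
   matrix [1 - P + 1 p^T]. *)
Lemma poisson_equation f : \sum_x p x * f x = 0 ->
  exists g, forall x, g x - mact P g x = f x.
Proof.
move=> f0.
pose A : 'M[R]_m.+1 := \matrix_(x, y) ((x == y)%:R - P x y + p y).
have AE (v : 'cV[R]_m.+1) x : (A *m v) x 0 =
    v x 0 - mact P (fun y => v y 0) x + \sum_y p y * v y 0.
  rewrite mxE /mact -sumrN.
  rewrite -[X in X + _ + _](_ : \sum_y (x == y)%:R * v y 0 = _); last first.
    rewrite (bigD1 x) //= eqxx mul1r big1 ?addr0 // => y.
    by rewrite eq_sym => /negPf ->; rewrite mul0r.
  rewrite -!big_split; apply: eq_bigr => y _ /=; rewrite mxE; ring.
have pA (v : 'cV[R]_m.+1) : \sum_x p x * (A *m v) x 0 = \sum_x p x * v x 0.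
  under eq_bigr => x _ do rewrite AE mulrDr mulrBr.
  rewrite big_split sumrB /= (mean_mact _ hp) subrr add0r -mulr_suml hp.1.2.
  by rewrite mul1r.
have Au : A \in unitmx.
  rewrite -unitmx_tr -row_free_unit -kermx_eq0; apply/rowV0P => u /sub_kermxP uA.
  have Au : A *m u^T = 0 by rewrite -[A *m _]trmxK trmx_mul trmxK uA trmx0.
  have u0 : \sum_x p x * u^T x 0 = 0.
    by rewrite -pA Au big1 // => x _; rewrite mxE mulr0.
  have fix_u : mact P (fun y => u^T y 0) =1 (fun y => u^T y 0).
    move=> x; have := AE u^T x; rewrite u0 addr0 Au mxE => /eqP.
    by rewrite eq_sym subr_eq0 => /eqP <-.
  by apply/rowP => x; have := gap_fixed0 u0 fix_u x; rewrite !mxE.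
pose F : 'cV[R]_m.+1 := \col_x f x.
have [G AF] : exists G : 'cV[R]_m.+1, A *m G = F.
  by exists (invmx A *m F); rewrite mulKVmx.
exists (fun x => G x 0) => x.
have sG : \sum_y p y * G y 0 = 0.
  by rewrite -pA AF -[RHS]f0; apply: eq_bigr => y _; rewrite mxE.
by have := AE G x; rewrite AF sG addr0 mxE => ->.
Qed.

(** With [h] split into its mean [a] and a mean-zero part, [expR_sqr_bound] is averaged over [p].
    The terms linear in [u] and in [v] vanish, and the factor [1 + e] on the square of [v] is
    absorbed by the gap, as [(1 + e) * (1 - e) <= 1]. *)
Lemma tilted_contraction u (t : R) h : (forall x, `|u x| <= 1) ->
  \sum_x p x * u x = 0 -> 0 <= t -> t <= e / 8 ->
  \sum_x p x * (expR (t * u x) * mact P h x ^+ 2) <=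
    (1 + 4 * (t ^+ 2 / e)) * \sum_x p x * h x ^+ 2.
Proof.
move=> u1 u0 t0 te.
set a := \sum_x p x * h x; pose h0 x := h x - a.
have h00 : \sum_x p x * h0 x = 0.
  under eq_bigr do rewrite mulrBr.
  by rewrite sumrB -mulr_suml hp.1.2 mul1r subrr.
pose v := mact P h0.
have Ph x : mact P h x = a + v x.
  have -> : mact P h x = mact P (fun y => a + h0 y) x.
    by apply: eq_bigr => y _; rewrite /h0 addrC subrK.
  by rewrite mactD mact_cst.
have v0 : \sum_x p x * v x = 0 by rewrite mean_mact.
have hh : \sum_x p x * h x ^+ 2 = a ^+ 2 + \sum_x p x * h0 x ^+ 2.
  have -> : \sum_x p x * h x ^+ 2 =
    \sum_x (p x * a ^+ 2 + 2 * a * (p x * h0 x) + p x * h0 x ^+ 2).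
    by apply: eq_bigr => x _; rewrite /h0; ring.
  by rewrite !big_split /= -mulr_sumr h00 mulr0 addr0 -mulr_suml hp.1.2 mul1r.
have gv := gap h00; rewrite -/v in gv.
set H := \sum_x p x * h0 x ^+ 2 in gv hh *.
have H0 : 0 <= H by apply: sumr_ge0 => x _; rewrite mulr_ge0 ?sqr_ge0 // ltW.
apply: (@le_trans _ _ (\sum_x (p x * (a ^+ 2 * (1 + 4 * (t ^+ 2 / e))) +
   t * a ^+ 2 * (p x * u x) + 2 * a * (p x * v x) + (1 + e) * (p x * v x ^+ 2)))).
  apply: ler_sum => x _.
  have tu : `|t * u x| <= t by rewrite normrM ger0_norm // ler_piMr.
  have h1 := expR_sqr_bound a (v x) e0 e1 t0 te tu.
  rewrite Ph; apply: le_trans (ler_wpM2l (ltW (p0 x)) h1) _.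
  by rewrite le_eqVlt; apply/orP; left; apply/eqP; ring.
rewrite !big_split /= -!mulr_sumr -mulr_suml hp.1.2 u0 v0 !mulr0 mul1r !addr0.
set c := t ^+ 2 / e.
have c0 : 0 <= c by rewrite /c divr_ge0 ?sqr_ge0 // ltW.
have : (1 + e) * (\sum_x p x * v x ^+ 2) <= (1 + e) * ((1 - e) * H).
  by rewrite ler_wpM2l //; lra.
have : 0 <= e ^+ 2 * H by rewrite mulr_ge0 ?sqr_ge0.
have : 0 <= c * H by rewrite mulr_ge0.
rewrite hh; nra.
Qed.

(* [exp_moment th u s x] is the expectation of [exp (th * sum of u)] over the
   first [s] states of the chain started at [x]. *)
Fixpoint exp_moment (th : R) u (s : nat) : 'I_m.+1 -> R :=
  if s is s'.+1 then fun x => expR (th * u x) * mact P (exp_moment th u s') x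
  else fun=> 1.

Lemma exp_moment_ge0 th u s x : 0 <= exp_moment th u s x.
Proof.
elim: s x => [|s IH] x /=; first exact: ler01.
by rewrite mulr_ge0 ?expR_ge0 // sumr_ge0 // => y _; rewrite mulr_ge0 // hP.1.
Qed.

(** Iterating [tilted_contraction] bounds the squared [l_2(p)] norm. Squaring doubles the exponent,
    hence the parameter [t / 2]; the square root halves the rate [4 t^2 / e]. Keeping one state of
    the norm costs the root of [1 / p x], which is at most [1 / p x]. *)
Lemma exp_moment_le u (t : R) s x : (forall x, `|u x| <= 1) ->
  \sum_x p x * u x = 0 -> 0 <= t -> t <= e / 8 ->
  exp_moment (t / 2) u s x <= (p x)^-1 * expR (2 * (t ^+ 2 / e) * s%:R).
Proof.
move=> u1 u0 t0 te.
set c := t ^+ 2 / e.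
have c0 : 0 <= c by rewrite /c divr_ge0 ?sqr_ge0 // ltW.
have nrm k : \sum_x p x * exp_moment (t / 2) u k x ^+ 2 <= expR (4 * c) ^+ k.
  elim: k => [|k IH] /=.
    by under eq_bigr do rewrite expr1n mulr1; rewrite hp.1.2 expr0.
  have -> : \sum_x p x * (expR (t / 2 * u x) * mact P (exp_moment (t / 2) u k) x) ^+ 2
      = \sum_x p x * (expR (t * u x) * mact P (exp_moment (t / 2) u k) x ^+ 2).
    apply: eq_bigr => y _; rewrite exprMn -expRM_natl; congr (_ * (expR _ * _)).
    by field.
  apply: (le_trans (tilted_contraction _ u1 u0 t0 te)).
  rewrite [leRHS]exprS ler_pM //.
  - by rewrite addr_ge0 // mulr_ge0.
  - by apply: sumr_ge0 => y _; rewrite mulr_ge0 ?sqr_ge0 // ltW.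
  - exact: expR_ge1Dx.
have px1 : p x <= 1.
  rewrite -hp.1.2 (bigD1 x) //= lerDl sumr_ge0 // => y _; exact: ltW.
set M := exp_moment _ _ _ _; set E := expR _.
have E0 : 0 <= E by exact: expR_ge0.
have M0 : 0 <= M by exact: exp_moment_ge0.
have : p x * M ^+ 2 <= E ^+ 2.
  have -> : E ^+ 2 = expR (4 * c) ^+ s.
    by rewrite /E -expRM_natl -expRM_natr; congr expR; ring.
  apply: le_trans (nrm s); rewrite (bigD1 x) //= lerDl sumr_ge0 // => y _.
  by rewrite mulr_ge0 ?sqr_ge0 // ltW.
move=> h; rewrite [leRHS]mulrC ler_pdivlMr // [leLHS]mulrC.
rewrite -(@ler_pXn2r _ 2) ?nnegrE ?mulr_ge0 // ?(ltW (p0 x)) //.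
apply: le_trans h; rewrite exprMn expr2 -mulrA ler_piMl // mulr_ge0 ?sqr_ge0 //.
exact: ltW.
Qed.
End ChainGap.

(** * Expectations over sample paths *)

Section Paths.
Variables (R : realType) (K : nat) (nS : 'I_K -> nat) (n : nat).
Local Notation W := (path_space K nS n).
Local Notation St i := ('I_(nS i).+1).
Implicit Types (w : W) (i j : 'I_K) (k l : 'I_n.+1).

Definition upd w i k (y : St i) : W :=
  [ffun j : 'I_K => @eqtype.dfwith _ (fun j => {ffun 'I_n.+1 -> St j}) (fun j => w j) i
    [ffun l => if l == k then y else w i l] j].

Lemma upd_in w i k (y : St i) l : upd w k y i l = if l == k then y else w i l.
Proof. by rewrite ffunE dfwith_in ffunE. Qed.

Lemma upd_out w i k (y : St i) j : i != j -> upd w k y j = w j.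
Proof. by move=> ij; rewrite ffunE dfwith_out. Qed.

Lemma updK w i k (y : St i) : upd (upd w k y) k (w i k) = w.
Proof.
apply/ffunP => j; case: (eqVneq i j) => [<-|ij]; last by rewrite !upd_out.
by apply/ffunP => l; rewrite !upd_in; case: eqP => [->|].
Qed.

(* Resampling one coordinate: [(w, y) |-> (upd w k y, w i k)] is an involution. *)
Lemma sum_upd i k (F : W -> R) :
  \sum_w \sum_(y : St i) F (upd w k y) = (nS i).+1%:R * \sum_w F w.
Proof.
rewrite pair_big /=.
pose h (wy : W * St i) := (upd wy.1 k wy.2, wy.1 i k).
have hK : involutive h.
  by case=> w y; rewrite /h /= updK upd_in eqxx.
rewrite (eq_bigr (fun wy => F (h wy).1)) //.
rewrite (reindex_inj (inv_inj hK)).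
under eq_bigr do rewrite hK.
rewrite -(pair_big xpredT xpredT (fun w _ => F w)) /= mulr_sumr.
by apply: eq_bigr => w _; rewrite sumr_const card_ord mulr_natl.
Qed.

(** Measurability is encoded as invariance under resampling a coordinate. A [past_only i s] function
    may read every state of the other arms, and states [0] to [s] of arm [i]. *)
Definition arm_free i (F : W -> R) := forall w k (y : St i), F (upd w k y) = F w.
Definition past_only i (s : nat) (F : W -> R) :=
  forall w k (y : St i), (s < k)%N -> F (upd w k y) = F w.

Variables (P : forall i : 'I_K, 'M[R]_((nS i).+1)) (init : forall i, St i -> R).
Hypotheses (hP : forall i, stochastic (P i)) (hi : forall i, prob_vec (@init i)).

Definition chain_weight i w (s : nat) : R :=
  init (w i ord0) * \prod_(k < s) P i (w i (inord k)) (w i (inord k.+1)).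

Lemma inord_neq (a b : nat) : (a <= n)%N -> (b <= n)%N -> a != b ->
  (inord a == inord b :> 'I_n.+1) = false.
Proof.
move=> an bn ab; apply/negP => /eqP/(congr1 val) /=.
by rewrite !inordK // => e; rewrite e eqxx in ab.
Qed.

Lemma chain_weight_upd i w (s : nat) k (y : St i) : (s < k)%N ->
  chain_weight i (upd w k y) s = chain_weight i w s.
Proof.
move=> sk; have kn : (k <= n)%N by rewrite -ltnS.
have eqF (a : nat) : (a <= s)%N -> (inord a == k) = false.
  move=> as_; rewrite -[k]inord_val inord_neq //.
    by rewrite (leq_trans as_) // (leq_trans (ltnW sk)).
  by rewrite ltn_eqF // (leq_ltn_trans as_).
rewrite /chain_weight; congr (_ * _).
  have := eqF 0%N (leq0n _); rewrite upd_in.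
  have -> : inord 0 = ord0 :> 'I_n.+1 by apply/val_inj; rewrite /= inordK.
  by move=> ->.
by apply: eq_bigr => a _; rewrite !upd_in !eqF // ltnW.
Qed.

(** Sums run over complete paths, so a coordinate that the summand ignores is counted once per
    state, whence the factor on the left. Resampling coordinate [s.+1] then averages [g] over one
    transition. *)
Lemma chain_weight_step i (Q F : W -> R) (g : St i -> R) (s : nat) :
  (s < n)%N -> arm_free i Q -> past_only i s F ->
  (nS i).+1%:R * \sum_w chain_weight i w s.+1 * Q w * (F w * g (w i (inord s.+1))) =
  \sum_w chain_weight i w s * Q w * (F w * mact (P i) g (w i (inord s))).
Proof.
move=> sn hQ hF; rewrite -(sum_upd i (inord s.+1)); apply: eq_bigr => w _.
have sv : (inord s.+1 : 'I_n.+1) = s.+1 :> nat by rewrite inordK.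
rewrite /mact !mulr_sumr; apply: eq_bigr => y _.
rewrite hQ hF ?sv // upd_in eqxx.
have -> : chain_weight i (upd w (inord s.+1) y) s.+1 =
    chain_weight i w s * P i (w i (inord s)) y.
  rewrite -(@chain_weight_upd i w s (inord s.+1) y) ?sv //.
  have e1 : upd w (inord s.+1) y i (inord s) = w i (inord s).
    by rewrite upd_in (inord_neq (ltnW sn) sn) // ltn_eqF.
  have e2 : upd w (inord s.+1) y i (inord s.+1) = y by rewrite upd_in eqxx.
  by rewrite {1}/chain_weight big_ord_recr mulrA e1 e2.
ring.
Qed.

(** This is [chain_weight_step] with [g = 1], repeated: each future transition sums to 1 and leaves
    one counting factor. *)
Lemma chain_weight_tail i (Q F : W -> R) (s d : nat) :
  (s + d <= n)%N -> arm_free i Q -> past_only i s F ->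
  (nS i).+1%:R ^+ d * \sum_w chain_weight i w (s + d) * Q w * F w =
  \sum_w chain_weight i w s * Q w * F w.
Proof.
move=> sdn hQ hF; elim: d sdn => [|d IH] sdn.
  by rewrite expr0 mul1r addn0.
rewrite -IH; last by rewrite (leq_trans _ sdn) // leq_add2l.
rewrite exprSr -mulrA; congr (_ * _); rewrite addnS.
rewrite addnS in sdn.
have hF' : past_only i (s + d) F.
  by move=> w k y h; apply: hF; apply: leq_ltn_trans h; apply: leq_addr.
have := @chain_weight_step i Q F (fun=> 1) (s + d) sdn hQ hF'.
under eq_bigr do rewrite mulr1.
move=> ->; apply: eq_bigr => w _.
by rewrite mact_cst // mulr1.
Qed.

(** The transitions after [s.+1] are summed out on the left and those after [s] on the right; one
    step relates the results and the counting factors cancel. *)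
Lemma chain_weight_markov i (Q F : W -> R) (g : St i -> R) (s : nat) :
  (s < n)%N -> arm_free i Q -> past_only i s F ->
  \sum_w chain_weight i w n * Q w * (F w * g (w i (inord s.+1))) =
  \sum_w chain_weight i w n * Q w * (F w * mact (P i) g (w i (inord s))).
Proof.
move=> sn hQ hF.
have c0 d : (nS i).+1%:R ^+ d != 0 :> R by rewrite expf_neq0 // pnatr_eq0.
have h1 : past_only i s.+1 (fun w => F w * g (w i (inord s.+1))).
  move=> w k y h; rewrite hF ?(ltnW h) // upd_in.
  have kn : (k <= n)%N by rewrite -ltnS.
  by rewrite -[k]inord_val (inord_neq sn kn (negbT (ltn_eqF h))).
have h2 : past_only i s (fun w => F w * mact (P i) g (w i (inord s))).
  move=> w k y h; rewrite hF // upd_in.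
  have kn : (k <= n)%N by rewrite -ltnS.
  by rewrite -[k]inord_val (inord_neq (ltnW sn) kn (negbT (ltn_eqF h))).
have e1 : (s.+1 + (n - s.+1))%N = n by rewrite subnKC.
have e2 : (s + (n - s))%N = n by rewrite subnKC // ltnW.
apply: (mulfI (c0 (n - s)%N)).
have := chain_weight_tail _ hQ h2 (d := n - s); rewrite e2 => ->; last exact: leqnn.
rewrite -(@chain_weight_step i Q F g s sn hQ hF).
rewrite -[X in _ = _ * X](@chain_weight_tail i Q _ s.+1 (n - s.+1) _ hQ h1) ?e1 //.
by rewrite mulrA -exprS -subSn // subSS.
Qed.

Lemma chain_weight_free i j : i != j -> arm_free i (fun w => chain_weight j w n).
Proof. by move=> ij w k y; rewrite /chain_weight upd_out. Qed.

Lemma chain_weight_total i (Q : W -> R) : arm_free i Q ->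
  (nS i).+1%:R ^+ n.+1 * \sum_w chain_weight i w n * Q w = \sum_w Q w.
Proof.
move=> hQ.
have h1 : past_only i 0 (fun=> 1) by [].
have := @chain_weight_tail i Q _ 0 n (leqnn _) hQ h1.
under eq_bigr do rewrite mulr1.
under [in RHS]eq_bigr do rewrite mulr1.
rewrite exprS -mulrA => ->.
rewrite -(sum_upd i ord0); apply: eq_bigr => w _.
under eq_bigr => y _ do rewrite hQ /chain_weight upd_in eqxx big_ord0 mulr1.
by rewrite -mulr_suml (hi i).2 mul1r.
Qed.

Definition Ex (F : W -> R) := \sum_w path_prob R K nS n P init w * F w.

Lemma path_probE i w : path_prob R K nS n P init w =
  chain_weight i w n * \prod_(j | j != i) chain_weight j w n.
Proof. by rewrite /path_prob (bigD1 i). Qed.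

Lemma path_prob_ge0 w : 0 <= path_prob R K nS n P init w.
Proof.
apply: prodr_ge0 => i _; rewrite mulr_ge0 ?(hi i).1 //.
by apply: prodr_ge0 => k _; rewrite (hP i).1.
Qed.

(** The weights of the other arms play the part of [Q]. Conditioning is thus on the past of arm [i]
    and the whole paths of the others, which lets [F] encode decisions of a policy that watches all
    arms. *)
Lemma Ex_markov i (F : W -> R) (g : St i -> R) (s : nat) :
  (s < n)%N -> past_only i s F ->
  Ex (fun w => F w * g (w i (inord s.+1))) =
  Ex (fun w => F w * mact (P i) g (w i (inord s))).
Proof.
move=> sn hF; rewrite /Ex; under eq_bigr do rewrite (path_probE i).
under [RHS]eq_bigr do rewrite (path_probE i).
apply: chain_weight_markov => // w k y; apply: eq_bigr => j ji.
by apply: chain_weight_free; rewrite eq_sym.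
Qed.

Lemma Ex1 : Ex (fun=> 1) = 1.
Proof.
(* Arms are summed out one at a time. Each contributes the inverse of its number of paths, and
   together these cancel the size of the path space. *)
have gen (s : seq 'I_K) : uniq s ->
    \sum_w \prod_(j <- s) chain_weight j w n =
    #|{: W}|%:R / \prod_(j <- s) (nS j).+1%:R ^+ n.+1.
  elim: s => [_|i s IH /= /andP[is_ us]].
    under [LHS]eq_bigr do rewrite big_nil.
    by rewrite big_nil divr1 sumr_const.
  rewrite big_cons invfM mulrCA -IH //.
  rewrite -[in RHS](@chain_weight_total i); last first.
    move=> w k y; apply: eq_big_seq => j js.
    have ij : i != j by apply: contraNneq is_ => ->.
    exact: (chain_weight_free ij).
  rewrite mulKf ?expf_neq0 ?pnatr_eq0 //.
  by apply: eq_bigr => w _; rewrite big_cons.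
transitivity (\sum_w \prod_(j <- enum 'I_K) chain_weight j w n).
  by apply: eq_bigr => w _; rewrite mulr1 big_enum.
rewrite gen ?enum_uniq // card_dep_ffun foldrE big_map /=.
rewrite natr_prod; under [in X in X / _]eq_bigr do rewrite card_ffun !card_ord natrX.
rewrite divff // prodf_seq_neq0; apply/allP => j _.
by rewrite expf_neq0 // pnatr_eq0.
Qed.

Lemma le_Ex (F G : W -> R) : (forall w, F w <= G w) -> Ex F <= Ex G.
Proof. by move=> h; apply: ler_sum => w _; rewrite ler_wpM2l ?path_prob_ge0. Qed.

Lemma Ex_cst c : Ex (fun=> c) = c.
Proof.
have := Ex1; rewrite /Ex; under eq_bigr do rewrite mulr1.
by rewrite -mulr_suml => ->; rewrite mul1r.
Qed.

Lemma ExD F G : Ex (fun w => F w + G w) = Ex F + Ex G.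
Proof. by rewrite /Ex -big_split; apply: eq_bigr => w _; rewrite mulrDr. Qed.

Lemma ExZ c F : Ex (fun w => c * F w) = c * Ex F.
Proof. by rewrite /Ex mulr_sumr; apply: eq_bigr => w _; rewrite mulrCA. Qed.

Lemma Ex_sum (I : Type) (s : seq I) (A : pred I) (F : I -> W -> R) :
  Ex (fun w => \sum_(j <- s | A j) F j w) = \sum_(j <- s | A j) Ex (F j).
Proof.
rewrite /Ex exchange_big /=; apply: eq_bigr => w _.
by rewrite mulr_sumr.
Qed.

Lemma Ex_exp_moment i (th : R) (u : St i -> R) (s : nat) (c : R) : (s <= n)%N ->
  (forall x, exp_moment (P i) th u s x <= c) ->
  Ex (fun w => \prod_(k < s) expR (th * u (w i (inord k)))) <= c.
Proof.
move=> sn hc.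
(* Interpolation between [j = 0], a value of [exp_moment] at the initial state, and [j = s], the
   full product: the factors from [j] on are replaced by their conditional expectation given state
   [j]. *)
have gen (j : nat) : (j <= s)%N ->
    Ex (fun w => (\prod_(k < j) expR (th * u (w i (inord k)))) *
                 exp_moment (P i) th u (s - j) (w i (inord j))) <= c.
  elim: j => [_|j IH js].
    rewrite -[leRHS]Ex_cst; apply: le_Ex => w.
    by rewrite big_ord0 mul1r subn0.
  apply: le_trans (IH (ltnW js)).
  have jn : (j < n)%N := leq_trans js sn.
  rewrite (@Ex_markov i) //.
    apply: le_Ex => w; rewrite big_ord_recr /= -[(s - j)%N]subnSK //=.
    by rewrite mulrA.
  move=> w k y jk; apply: eq_bigr => a _; rewrite upd_in.
  have kn : (k <= n)%N by rewrite -ltnS.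
  have aj : (a <= j)%N by rewrite -ltnS.
  rewrite -[k]inord_val (@inord_neq a k) ?(leq_trans aj (ltnW jn)) //.
  by rewrite neq_ltn (leq_ltn_trans aj jk).
apply: le_trans (gen s (leqnn _)).
by apply: le_Ex => w; rewrite subnn /= mulr1.
Qed.

End Paths.

(** * Concentration and elementary bounds *)

Section Concentration.
Variables (R : realType) (K : nat) (nS : 'I_K -> nat) (n : nat).
Local Notation W := (path_space K nS n).
Local Notation St i := ('I_(nS i).+1).
Variables (P : forall i : 'I_K, 'M[R]_((nS i).+1)) (init : forall i, St i -> R).
Hypotheses (hP : forall i, stochastic (P i)) (hi : forall i, prob_vec (@init i)).
Local Notation Ex := (@Ex R K nS n P init).

Lemma path_concentration (i : 'I_K) (p f : St i -> R) (e b c gam : R) (s : nat) :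
  stationary (P i) p -> (forall x, 0 < p x) -> 0 < e -> e <= 1 ->
  (forall h, \sum_x p x * h x = 0 ->
    \sum_x p x * mact (P i) h x ^+ 2 <= (1 - e) * \sum_x p x * h x ^+ 2) ->
  0 < b -> (forall x, `|f x| <= b) -> \sum_x p x * f x = 0 ->
  (forall x, (p x)^-1 <= c) -> 0 <= gam -> (0 < s)%N -> (s <= n)%N ->
  Ex (fun w => (s%:R * gam <= \sum_(k < s) f (w i (inord k)))%R%:R) <=
    c * expR (- (s%:R * gam ^+ 2 * e / (32 * b ^+ 2))).
Proof.
move=> hp p0 e0 e1 gap b0 fb f0 hc g0 s0 sn.
have s0R : 0 < s%:R :> R by rewrite ltr0n.
have c0 : 0 <= c by apply: le_trans (hc ord0); rewrite invr_ge0 ltW.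
(* For [gam > b] the event is impossible. Otherwise [g <= 1], which keeps the tilt [t] within
   [e / 8]. *)
have [bg|gb] := ltP b gam.
  apply: (@le_trans _ _ 0); last by rewrite mulr_ge0 ?expR_ge0.
  rewrite -[leRHS](@Ex_cst R K nS n P init hP hi 0); apply: le_Ex => // w.
  have [h|//] := leP (s%:R * gam); exfalso.
  have : \sum_(k < s) f (w i (inord k)) <= s%:R * b.
    rewrite -[s in leRHS]card_ord mulr_natl -sumr_const; apply: ler_sum => k _.
    exact: le_trans (ler_norm _) (fb _).
  by move=> /(le_trans h); rewrite ler_pM2l // leNgt bg.
(* This [t] minimises the Chernoff exponent [2 t^2 s / e - t s g / 2], whose minimum is
   [- s g^2 e / 32]. *)
pose g := gam / b; pose t := g * e / 8; pose u x := f x / b.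
have g0' : 0 <= g by rewrite divr_ge0 // ltW.
have g1 : g <= 1 by rewrite ler_pdivrMr // mul1r.
have u1 x : `|u x| <= 1 by rewrite normrM normfV (gtr0_norm b0) ler_pdivrMr // mul1r.
have u0 : \sum_x p x * u x = 0.
  by under eq_bigr do rewrite mulrA; rewrite -mulr_suml f0 mul0r.
have t0 : 0 <= t by rewrite /t divr_ge0 // mulr_ge0 // ltW.
have te : t <= e / 8 by rewrite /t ler_pM2r ?invr_gt0 // ler_piMl // ltW.
set E := expR (2 * (t ^+ 2 / e) * s%:R).
have mom : Ex (fun w => \prod_(k < s) expR (t / 2 * u (w i (inord k)))) <= c * E.
  apply: Ex_exp_moment => // x.
  apply: le_trans (exp_moment_le (hP i) hp p0 e0 e1 gap s x u1 u0 t0 te) _.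
  by rewrite ler_wpM2r ?expR_ge0.
pose d := expR (- (t / 2 * (s%:R * g))).
apply: (@le_trans _ _ (Ex (fun w =>
    d * \prod_(k < s) expR (t / 2 * u (w i (inord k)))))).
  apply: le_Ex => // w.
  have -> : \prod_(k < s) expR (t / 2 * u (w i (inord k))) =
     expR (t / 2 * (\sum_(k < s) f (w i (inord k)) / b)).
    by rewrite -expR_sum mulr_sumr.
  rewrite -expRD; have [h|_] := leP (s%:R * gam); last exact: expR_ge0.
  apply: le_trans (expR_ge1Dx _); rewrite lerDl -mulrN -mulrDr.
  apply: mulr_ge0; first exact: divr_ge0.
  by rewrite addrC subr_ge0 -mulr_suml /g mulrA ler_pM2r ?invr_gt0.
rewrite ExZ mulrC; apply: le_trans (_ : (c * E) * d <= _).
  by rewrite ler_wpM2r // expR_ge0.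
rewrite -mulrA -expRD ler_wpM2l // ler_expR le_eqVlt; apply/orP; left; apply/eqP.
by rewrite /t /g; field; rewrite !gt_eqF.
Qed.
End Concentration.

(** * Elementary series and minima *)

Section Elementary.
Variable R : realType.

(** Induction against the telescoping bound [2 - 1 / (k + 1)]. The term [t = 0] is 0, since the
    inverse of 0 is 0, so sums over slots may start there. *)
Lemma sum_inv_sqr_le (n : nat) : \sum_(t < n) (t%:R ^- 2) <= 2 :> R.
Proof.
have gen (k : nat) : \sum_(t < k.+2) (t%:R ^- 2) <= 2 - k.+1%:R^-1 :> R.
  elim: k => [|k IH].
    by rewrite !big_ord_recr big_ord0 /= !expr2 mulr0 invr0 !mulr1 invr1; lra.
  rewrite big_ord_recr /=; apply: le_trans (lerD IH (lexx _)) _.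
  have k0 : 0 < k.+1%:R :> R by rewrite ltr0n.
  have e2 : k.+2%:R = k.+1%:R + 1 :> R by rewrite -natr1.
  rewrite e2; set x := k.+1%:R in k0 *.
  have -> : 2 - x^-1 + (x + 1) ^- 2 =
     2 - (x + 1)^-1 - (x * (x + 1) ^+ 2)^-1.
    by field; rewrite !gt_eqF //; lra.
  rewrite lerBlDr lerDl invr_ge0 mulr_ge0 ?sqr_ge0 //; exact: ltW.
case: n => [|[|n]]; first by rewrite big_ord0.
  by rewrite big_ord_recr big_ord0 /= expr2 mulr0 invr0 addr0.
by apply: le_trans (gen n) _; rewrite lerBlDr lerDl invr_ge0.
Qed.

(** A limit inherits the sign of the partial sums once they converge, which they do as a
    nondecreasing sequence bounded by 2. *)
Lemma beta_ge0 : 0 <= beta R.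
Proof.
apply: limr_ge.
  apply: nondecreasing_is_cvgn.
    apply/nondecreasing_seqP => k; rewrite /series /= big_nat_recr //= lerDl.
    by rewrite divr_ge0 // sqr_ge0.
  exists 2 => _ [k _ <-]; rewrite /series /= big_mkord.
  apply: le_trans (sum_inv_sqr_le k.+1).
  rewrite big_ord_recl /= expr2 mulr0 invr0 add0r.
  by apply: ler_sum => t _; rewrite mul1r.
by apply: nearW => k; rewrite /series /= sumr_ge0.
Qed.

Lemma fmin_ge0 (I : finType) (F : I -> R) : (forall i, 0 <= F i) -> 0 <= fmin F.
Proof.
move=> F0; rewrite /fmin; apply: (big_ind (fun x => 0 <= x)) => //.
  by apply: (big_ind (fun x => 0 <= x)) => // x y x0 y0; rewrite le_max x0.
by move=> x y x0 y0; rewrite le_min x0.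
Qed.

Lemma fmin_gt0 (I : finType) (F : I -> R) : I -> (forall i, 0 < F i) -> 0 < fmin F.
Proof.
move=> i F0; rewrite /fmin; apply: (big_ind (fun x => 0 < x)) => //.
  by apply: lt_le_trans (F0 i) _; rewrite (bigmaxD1 i) // le_max lexx.
by move=> x y x0 y0; rewrite lt_min x0.
Qed.

Lemma fmin_le (I : finType) (F : I -> R) i : fmin F <= F i.
Proof. by rewrite /fmin (bigminD1 i) // ge_min lexx. Qed.
End Elementary.

(** * The UCB policy *)

Section Ucb.
Variables (R : realType) (K : nat) (nS : 'I_K -> nat).
Local Notation St i := ('I_(nS i).+1).
Variables (r : forall i : 'I_K, St i -> R) (L : R).
Variables (sched : nat -> {set 'I_K}) (tb : nat -> ('I_K -> R) -> {set 'I_K}).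
Variable n : nat.
Local Notation W := (path_space K nS n).
Implicit Types (w : W) (i j : 'I_K).
Local Notation cnt := (counts R K nS r L sched tb n).
Local Notation playT := (play R K nS r L sched tb n).
Local Notation A w t := (playT w t (cnt w t)).

Lemma counts_sum w t i : cnt w t i = (\sum_(s < t) (i \in A w s))%N.
Proof. by elim: t => [|t IH]; rewrite ?big_ord0 // big_ord_recr /= -IH. Qed.

Lemma counts_le w t i : (cnt w t i <= t)%N.
Proof. by elim: t => [//|t IH] /=; case: (_ \in _); lia. Qed.

Lemma counts_mono w i s t : (s <= t)%N -> (cnt w s i <= cnt w t i)%N.
Proof.
move=> /subnK <-; elim: (t - s)%N => [//|d IH].
exact: leq_trans IH (leq_addr _ _).
Qed.

(** The index of arm [i] reads only its observations [0] to [T i - 1], so state [k] is still unseen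
    when the arms are chosen. *)
Lemma play_upd w i (k : 'I_n.+1) (y : St i) t (T : 'I_K -> nat) :
  (T i <= k)%N -> playT (upd w k y) t T = playT w t T.
Proof.
move=> Tk; rewrite /play; case: ifP => // _; congr (tb _ _).
apply/funext => j; rewrite /ucb_index /sample_mean; congr (_ / _ + _).
apply: eq_bigr => a _; case: (eqVneq i j) => [ij|ij]; last by rewrite upd_out.
case: j / ij a => a; rewrite upd_in.
have kn := ltn_ord k.
by rewrite -[k]inord_val (@inord_neq n a k) //; have := ltn_ord a; lia.
Qed.

Lemma counts_upd w i (k : 'I_n.+1) (y : St i) t :
  (cnt w t i <= k)%N -> cnt (upd w k y) t = cnt w t.
Proof.
elim: t => [//|t IH] /= h.
have h' : (cnt w t i <= k)%N by lia.
by rewrite (IH h') play_upd.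
Qed.

(** The stopping-time property of the counts: whether play number [s + 1] of arm [i] takes place in
    slot [t + 1] is settled before later states of that arm are seen. *)
Lemma past_only_play i t s :
  past_only i s (fun w => ((cnt w t i == s) && (i \in A w t))%:R : R).
Proof.
move=> w k y sk.
have [e|ne] := eqVneq (cnt w t i) s.
  by rewrite counts_upd ?e ?eqxx ?play_upd ?e // ltnW.
(* Had the resampled path count [s], undoing the resampling would give [w] the same count. *)
suff /negPf -> : cnt (upd w k y) t i != s by [].
apply: contra ne => /eqP e; rewrite -(@updK _ _ _ w i k y) counts_upd ?e //.
exact: ltnW.
Qed.

Lemma card_play M w t : valid_sched M sched -> valid_tb M tb -> #|A w t| = M.
Proof.
move=> [hs _] htb; rewrite /play; case: ifP => [/hs //|_].
by have [] := htb t (ucb_index R K nS r L n w t (cnt w t)).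
Qed.

Lemma sum_counts M w t : valid_sched M sched -> valid_tb M tb ->
  (\sum_i cnt w t i = t * M)%N.
Proof.
move=> hs ht; elim: t => [|t IH] /=; first by rewrite big1.
rewrite big_split /= IH mulSn addnC; congr addn.
rewrite -[RHS](card_play w t hs ht) -sum1_card [RHS]big_mkcond /=.
by apply: eq_bigr => i _; case: (i \in _).
Qed.

Lemma counts_ge M w t i : valid_sched M sched -> (K <= t)%N -> (M <= cnt w t i)%N.
Proof.
move=> [_ hs] Kt.
have : cnt w K i = M.
  rewrite counts_sum -[RHS](hs i) -sum1_card [RHS]big_mkcond /=; apply: eq_bigr => s _.
  by rewrite inE /play ltn_ord; case: (_ \in _).
by move=> <-; apply: counts_mono.
Qed.

(** Every play raises the count, so the plays so far never outnumber it, and the last one considered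
    has count at most [l]. The induction carries the bound by the current count along. *)
Lemma plays_below_le w i (l : R) m : 0 <= l ->
  (\sum_(t < m) ((i \in A w t) && ((cnt w t i)%:R <= l)%R : nat))%N%:R <= l + 1.
Proof.
move=> l0.
suff [] :
    (\sum_(t < m) ((i \in A w t) && ((cnt w t i)%:R <= l)%R : nat) <= cnt w m i)%N /\
    (\sum_(t < m) ((i \in A w t) && ((cnt w t i)%:R <= l)%R : nat))%N%:R <= l + 1.
  by [].
elim: m => [|m [IH1 IH2]]; first by rewrite big_ord0; split=> //; lra.
rewrite big_ord_recr /=; set Z := (\sum_(t < m) _)%N in IH1 IH2 *.
case: (i \in A w m) => /=; last by rewrite !addn0.
case: leP => h; rewrite ?addn0; last first.
  by split => //; exact: leq_trans IH1 (leq_addr _ _).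
split; first by rewrite leq_add2r.
rewrite natrD lerD2r; apply: le_trans h.
by rewrite ler_nat.
Qed.

Variable mu : 'I_K -> R.

Definition deviation w i (s : nat) : R := \sum_(k < s) (r (w i (inord k)) - mu i).
Definition width (t s : nat) : R := Num.sqrt (L * ln t%:R / s%:R).

Lemma width_ge0 t s : 0 <= width t s. Proof. exact: sqrtr_ge0. Qed.

Lemma sample_meanE w i s : (0 < s)%N ->
  s%:R * (sample_mean R K nS r n w i s - mu i) = deviation w i s.
Proof.
move=> s0; have sn0 : s%:R != 0 :> R by rewrite pnatr_eq0 -lt0n.
rewrite /sample_mean /deviation sumrB sumr_const card_ord -[mu i *+ s]mulr_natl.
by field.
Qed.

Variable M : nat.
Hypotheses (hM : (0 < M)%N) (hMK : (M <= K)%N) (L0 : 0 <= L).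
Hypotheses (hs : valid_sched M sched) (ht : valid_tb M tb).

Lemma play_pigeonhole w t i : (M <= i)%N -> i \in A w t ->
  exists2 j : 'I_K, (j < M)%N & j \notin A w t.
Proof.
move=> Mi iA; apply: contrapT => h.
have sub : [set widen_ord hMK a | a : 'I_M] \subset A w t :\ i.
  apply/fintype.subsetP => _ /imsetP[a _ ->]; rewrite !inE; apply/andP; split.
    by apply/eqP => /(congr1 val) /= e; have := ltn_ord a; lia.
  by apply: contrapT => /negP hn; apply: h; exists (widen_ord hMK a) => //=.
have := subset_leq_card sub; rewrite card_imset; last first.
  by move=> a b /(congr1 val) /= /val_inj.
rewrite card_ord => h1; have := cardsD1 i (A w t).
rewrite iA (card_play w t hs ht) add1n => e.
by move: h1; rewrite {1}e ltnn.
Qed.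

(** The threshold makes [width] of arm [i] less than [D / 2]; the factor 4 comes from this square.
    Some optimal [j] is left out. If neither deviation occurred, the index of [j] would exceed
    [mu j >= mu i + D], and that of [i] would stay below [mu i + 2 width < mu i + D], contradicting
    the choice of [i]. *)
Lemma bad_play w t i (D : R) : (K <= t)%N -> (t < n)%N -> (M <= i)%N ->
  0 < D -> (forall j, (j < M)%N -> mu i + D <= mu j) ->
  i \in A w t -> 4 * L * ln n%:R / D ^+ 2 < (cnt w t i)%:R ->
  (cnt w t i)%:R * width t (cnt w t i) <= deviation w i (cnt w t i) \/
  exists2 j : 'I_K, (j < M)%N &
    (cnt w t j)%:R * width t (cnt w t j) <= - deviation w j (cnt w t j).
Proof.
move=> Kt tn Mi D0 hD iA big.
have [j jM jA] := play_pigeonhole Mi iA.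
have idx : ucb_index R K nS r L n w t (cnt w t) j <=
    ucb_index R K nS r L n w t (cnt w t) i.
  move: iA jA; rewrite /play ltnNge Kt /= => iA jA.
  by have [_ h] := ht t (ucb_index R K nS r L n w t (cnt w t)); apply: h.
have c0 a : (0 < cnt w t a)%N by apply: leq_trans hM (counts_ge _ _ hs Kt).
have c0R a : 0 < (cnt w t a)%:R :> R by rewrite ltr0n.
rewrite /ucb_index -!/(width _ _) in idx.
set Ti := cnt w t i in big idx *; set Tj := cnt w t j in idx *.
have t0 : (0 < t)%N by have := ltn_ord i; lia.
have half : width t Ti < D / 2.
  have h1 : L * ln t%:R <= L * ln n%:R.
    by rewrite ler_wpM2l // ler_ln ?posrE ?ltr0n ?ler_nat; lia.
  have h2 : L * ln t%:R / Ti%:R < (D / 2) ^+ 2.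
    rewrite ltr_pdivrMr ?c0R //; apply: le_lt_trans h1 _.
    move: big; rewrite ltr_pdivrMr ?exprn_gt0 // => big.
    rewrite expr_div_n; lra.
  have D2 : 0 <= D / 2 by rewrite divr_ge0 // ltW.
  rewrite /width -[D / 2]ger0_norm // -sqrtr_sqr ltr_sqrt //.
  by rewrite exprn_gt0 // divr_gt0.
have [a|a] := leP (Ti%:R * width t Ti) (deviation w i Ti); first by left.
right; exists j => //; rewrite -/Tj.
rewrite leNgt; apply/negP => b.
move: a b; rewrite -!sample_meanE ?c0 // -mulrN !ltr_pM2l ?c0R //.
move=> a b; have := hD j jM; lra.
Qed.

End Ucb.

(** * Regret *)

Section Regret.
Variables (R : realType) (K : nat) (nS : 'I_K -> nat).
Local Notation St i := ('I_(nS i).+1).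
Variables (r : forall i : 'I_K, St i -> R) (L : R).
Variables (sched : nat -> {set 'I_K}) (tb : nat -> ('I_K -> R) -> {set 'I_K}).
Variable n : nat.
Local Notation W := (path_space K nS n).
Implicit Types (w : W) (i j : 'I_K).
Local Notation cnt := (counts R K nS r L sched tb n).
Local Notation playT := (play R K nS r L sched tb n).
Local Notation A w t := (playT w t (cnt w t)).
Variables (P : forall i : 'I_K, 'M[R]_((nS i).+1)) (init pi : forall i, St i -> R).
Hypotheses (hP : forall i, stochastic (P i)) (hi : forall i, prob_vec (@init i)).
Hypotheses (hpi : forall i, stationary (P i) (@pi i)).
Local Notation Ex := (@Ex R K nS n P init).
Local Notation mui := (mu r pi).

Lemma mean_deviation i : \sum_(x : St i) pi x * (r x - mui i) = 0.
Proof.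
under eq_bigr do rewrite mulrBr.
rewrite sumrB -mulr_suml (hpi i).1.2 mul1r /mu; apply/eqP.
by rewrite subr_eq0; apply/eqP/eq_bigr => x _; rewrite mulrC.
Qed.

(* Along a stopping time the Poisson solution [g] turns the centred rewards
   into a telescoping sum, up to a mean-zero term. *)
Lemma arm_reward_ge i (g : St i -> R) (G : R) :
  (forall x : St i, g x - mact (P i) g x = r x - mui i) -> (forall x, `|g x| <= G) ->
  - (2 * G) <= Ex (fun w => \sum_(t < n) (i \in A w t)%:R *
     (r (w i (inord (cnt w t i))) - mui i)).
Proof.
move=> hg gG.
(* Splitting by the value [s] of the random count lets [Ex_markov] act at a fixed position of the
   chain. *)
pose I (t s : nat) w : R := ((cnt w t i == s) && (i \in A w t))%:R.
have split_cnt t (h : W -> nat -> R) w : (t < n)%N ->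
    (i \in A w t)%:R * h w (cnt w t i) = \sum_(s < n) I t s w * h w s.
  move=> tn; have cn : (cnt w t i < n)%N.
    by apply: leq_ltn_trans tn; apply: counts_le.
  rewrite (bigD1 (Ordinal cn)) //= /I eqxx /= big1 ?addr0 // => s ne.
  by rewrite (_ : (cnt w t i == s) = false) ?mul0r //; apply/negbTE; rewrite eq_sym.
have step t : (t < n)%N ->
    Ex (fun w => (i \in A w t)%:R * (r (w i (inord (cnt w t i))) - mui i)) =
    Ex (fun w => (i \in A w t)%:R *
      (g (w i (inord (cnt w t i))) - g (w i (inord (cnt w t i).+1)))).
  move=> tn.
  transitivity (Ex (fun w => \sum_(s < n) I t s w * (r (w i (inord s)) - mui i))).
    apply: eq_bigr => w _.
    by rewrite -(split_cnt t (fun w s => r (w i (inord s)) - mui i)).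
  transitivity (Ex (fun w => \sum_(s < n) I t s w *
     (g (w i (inord s)) - g (w i (inord s.+1))))); last first.
    by apply: eq_bigr => w _; rewrite -(split_cnt t
      (fun w s => g (w i (inord s)) - g (w i (inord s.+1)))).
  rewrite !Ex_sum; apply: eq_bigr => s _.
  have Imark : Ex (fun w => I t s w * g (w i (inord s.+1))) =
      Ex (fun w => I t s w * mact (P i) g (w i (inord s))).
    by apply: Ex_markov => //; apply: past_only_play.
  transitivity (Ex (fun w => I t s w * g (w i (inord s)) +
      (-1) * (I t s w * mact (P i) g (w i (inord s))))).
    by apply: eq_bigr => w _; rewrite -hg; ring.
  rewrite ExD ExZ -Imark -ExZ -ExD.
  by apply: eq_bigr => w _; ring.
rewrite Ex_sum (eq_bigr _ (fun (t : 'I_n) _ => step t (ltn_ord t))) -Ex_sum.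
rewrite -[leLHS](@Ex_cst R K nS n P init hP hi); apply: le_Ex => // w.
(* The position of arm [i] moves exactly when it is played, so only the first and the current value
   of [g] survive. *)
have tel m : \sum_(t < m) (i \in A w t)%:R *
      (g (w i (inord (cnt w t i))) - g (w i (inord (cnt w t i).+1))) =
    g (w i (inord 0)) - g (w i (inord (cnt w m i))).
  elim: m => [|m IH]; first by rewrite big_ord0 /= subrr.
  rewrite big_ord_recr /= IH.
  by case: (i \in _); rewrite /= ?addn1 ?addn0 ?mul1r ?mul0r; ring.
rewrite tel.
have := gG (w i (inord 0)); have := gG (w i (inord (cnt w n i))).
rewrite !ler_norml => /andP[_ ?] /andP[? _]; lra.
Qed.

Variables (e : 'I_K -> R) (b c : R).
Hypotheses (pi0 : forall i (x : St i), 0 < pi x).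
Hypotheses (e0 : forall i, 0 < e i) (e1 : forall i, e i <= 1).
Hypothesis gap : forall i (h : St i -> R), \sum_x pi x * h x = 0 ->
    \sum_x pi x * mact (P i) h x ^+ 2 <= (1 - e i) * \sum_x pi x * h x ^+ 2.
Hypotheses (b0 : 0 < b) (rb : forall i (x : St i), `|r x - mui i| <= b).
Hypothesis (hc : forall i (x : St i), (pi x)^-1 <= c).
Hypothesis (hL : forall i, 3 * (32 * b ^+ 2) <= L * e i).

Let L0 i : 0 <= L.
Proof.
rewrite -(pmulr_lge0 _ (e0 i)); apply: le_trans (hL i).
by do 2![apply: mulr_ge0 => //]; exact: sqr_ge0.
Qed.

(** The width makes [s * width ^+ 2] equal to [L * ln t], so [s] drops out of the exponent, and [hL]
    makes that exponent at most [- 3 ln t]. A general [f] serves both signs of the deviation. *)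
Lemma deviation_prob i (f : St i -> R) (t s : nat) : (0 < t)%N -> (0 < s)%N ->
  (s <= n)%N -> (forall x, `|f x| <= b) -> \sum_x pi x * f x = 0 ->
  Ex (fun w => (s%:R * width L t s <= \sum_(k < s) f (w i (inord k)))%R%:R) <=
    c * t%:R ^- 3.
Proof.
move=> t0 s0 sn fb f0.
apply: le_trans (path_concentration hP hi (hpi i) (@pi0 i) (e0 i) (e1 i)
  (@gap i) b0 fb f0 (@hc i) (width_ge0 _ _ _) s0 sn) _.
have c0 : 0 <= c by apply: le_trans (hc (ord0 : St i)); rewrite invr_ge0 ltW.
have lnt : 0 <= ln t%:R :> R by rewrite ln_ge0 // ler1n.
have tR : 0 < t%:R :> R by rewrite ltr0n.
rewrite ler_wpM2l // -[t%:R in leRHS]lnK ?posrE // -expRM_natl -expRN ler_expR lerN2.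
rewrite /width sqr_sqrtr; last by rewrite divr_ge0 // mulr_ge0 ?(L0 i).
have -> : s%:R * (L * ln t%:R / s%:R) * e i / (32 * b ^+ 2) =
    ln t%:R * (L * e i / (32 * b ^+ 2)).
  by field; rewrite gt_eqF // pnatr_eq0 -lt0n.
rewrite mulrC ler_wpM2l // ler_pdivlMr //.
by rewrite mulr_gt0 // exprn_gt0.
Qed.

Variable M : nat.
Hypotheses (hM : (0 < M)%N) (hMK : (M <= K)%N).
Hypotheses (hs : valid_sched M sched) (ht : valid_tb M tb).

Lemma sum_ltn_le (m k : nat) : (\sum_(t < m) (t < k) <= k)%N.
Proof.
suff -> : (\sum_(t < m) (t < k) = minn m k)%N by apply: geq_minr.
elim: m => [|m IH]; first by rewrite big_ord0 min0n.
by rewrite big_ord_recr /= IH; case: ltnP => /=; lia.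
Qed.

Lemma expected_counts_le i (D : R) : (M <= i)%N -> 0 < D ->
  (forall j, (j < M)%N -> mui i + D <= mui j) ->
  Ex (fun w => (cnt w n i)%:R) <=
    4 * L * ln n%:R / D ^+ 2 + (1 + K%:R + K.+1%:R * c * 2).
Proof.
move=> Mi D0 hD.
set l := 4 * L * ln n%:R / D ^+ 2.
have lnn : 0 <= ln n%:R :> R.
  by case: (n) => [|k]; [rewrite ln0 | rewrite ln_ge0 // ler1n].
have l0 : 0 <= l by rewrite divr_ge0 ?sqr_ge0 // !mulr_ge0 // (L0 i).
have c0 : 0 <= c by apply: le_trans (hc (ord0 : St i)); rewrite invr_ge0 ltW.
(* The counts are random, so [bad] sums over all their possible values [1] to [t], for arm [i] and
   for each optimal arm. *)
pose up j t s w : R := (s%:R * width L t s <= deviation r mui w j s)%R%:R.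
pose lo j t s w : R := (s%:R * width L t s <= - deviation r mui w j s)%R%:R.
pose bad (t : nat) w : R :=
  \sum_(s < t) (up i t s.+1 w + \sum_(j < K | (j < M)%N) lo j t s.+1 w).
have bad0 t w : 0 <= bad t w.
  by apply: sumr_ge0 => s _; rewrite addr_ge0 // sumr_ge0.
(* A play of [i] falls in the first [K] slots, has a count of at most [l], or is paid for by
   [bad]. *)
have playb w t : (t < n)%N -> (i \in A w t)%:R <=
    (t < K)%N%:R + ((i \in A w t) && ((cnt w t i)%:R <= l)%R : nat)%:R +
    (if (K <= t)%N then bad t w else 0) :> R.
  move=> tn; case iA : (i \in A w t) => /=; last by case: ifP; rewrite !addr_ge0.
  have [Kt|tK] := leqP K t; last by rewrite addr0 lerDl.
  have [_|big] := leP ((cnt w t i)%:R : R) l; first by rewrite /= add0r lerDl.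
  rewrite /= !add0r.
  have cs a : exists2 s : 'I_t, cnt w t a = s.+1 & true.
    have ca : (0 < cnt w t a)%N by apply: leq_trans hM _; apply: counts_ge hs Kt.
    have h : ((cnt w t a).-1 < t)%N.
      by rewrite prednK //; exact: counts_le.
    by exists (Ordinal h) => //=; rewrite prednK.
  case: (bad_play hM hMK (L0 i) hs ht Kt tn Mi D0 hD iA big) => [h|[j jM h]].
    have [s es _] := cs i; rewrite es in h.
    rewrite /bad (bigD1 s) //= {1}/up h -addrA lerDl !addr_ge0 ?sumr_ge0 // => *.
    by rewrite addr_ge0 // sumr_ge0.
  have [s es _] := cs j; rewrite es in h.
  rewrite /bad (bigD1 s) //= (bigD1 j) //= {1}/lo h.
  rewrite addrCA -addrA lerDl !addr_ge0 ?sumr_ge0 // => *.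
  by rewrite addr_ge0 // sumr_ge0.
have cntb w : (cnt w n i)%:R <= (l + 1 + K%:R) +
    \sum_(t < n) (if (K <= t)%N then bad t w else 0) :> R.
  rewrite counts_sum natr_sum.
  apply: le_trans (ler_sum _ (fun (t : 'I_n) _ => playb w t (ltn_ord t))) _.
  rewrite !big_split /= lerD2r addrC -!natr_sum lerD //.
    exact: plays_below_le.
  by rewrite ler_nat sum_ltn_le.
apply: le_trans (le_Ex hP hi cntb) _.
rewrite ExD Ex_cst // Ex_sum -!addrA lerD2l lerD2l lerD2l.
(* At most [K + 1] events for each of [t] counts, each of probability at most [c / t^3]. *)
have badE (t : nat) : (t < n)%N -> Ex (fun w => if (K <= t)%N then bad t w else 0) <=
    K.+1%:R * c * t%:R ^- 2.
  move=> tn; have [Kt|tK] := leqP K t; last first.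
    by rewrite Ex_cst // !mulr_ge0 // invr_ge0 sqr_ge0.
  have t0 : (0 < t)%N by have := ltn_ord i; lia.
  have tR : 0 < t%:R :> R by rewrite ltr0n.
  have upE (s : 'I_t) : Ex (up i t s.+1) <= c * t%:R ^- 3.
    apply: (@deviation_prob i (fun x => r x - mui i)) => //.
    - by have := ltn_ord s; lia.
    - exact: mean_deviation.
  have loE j (s : 'I_t) : Ex (lo j t s.+1) <= c * t%:R ^- 3.
    have h := @deviation_prob j (fun x => - (r x - mui j)) t s.+1.
    apply: le_trans (h _ _ _ _ _) => //.
    - apply: le_Ex => // w; by rewrite /lo /deviation sumrN.
    - by have := ltn_ord s; lia.
    - by move=> x; rewrite normrN.
    - under eq_bigr do rewrite mulrN.
      by rewrite sumrN mean_deviation oppr0.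
  rewrite /bad Ex_sum.
  apply: (@le_trans _ _ (\sum_(s < t) (K.+1%:R * (c * t%:R ^- 3)))).
    apply: ler_sum => s _; rewrite ExD Ex_sum -natr1 addrC mulrDl mul1r lerD //.
    apply: (@le_trans _ _ (\sum_(j < K) c * t%:R ^- 3)).
      rewrite big_mkcond /=; apply: ler_sum => j _; case: ifP => // _.
      by rewrite mulr_ge0 // invr_ge0 exprn_ge0.
    by rewrite sumr_const card_ord mulr_natl.
  rewrite sumr_const card_ord -[leLHS]mulr_natl le_eqVlt; apply/orP; left; apply/eqP.
  by field; rewrite gt_eqF.
apply: le_trans (ler_sum _ (fun (t : 'I_n) _ => badE t (ltn_ord t))) _.
by rewrite -mulr_sumr ler_wpM2l ?sum_inv_sqr_le // mulr_ge0.
Qed.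

End Regret.

(** * Reduction of the regret to expected numbers of suboptimal plays *)

Section RegretBound.
Variables (R : realType) (K : nat) (nS : 'I_K -> nat).
Local Notation St i := ('I_(nS i).+1).
Variables (r : forall i : 'I_K, St i -> R) (L : R).
Variables (sched : nat -> {set 'I_K}) (tb : nat -> ('I_K -> R) -> {set 'I_K}).
Variable n : nat.
Local Notation W := (path_space K nS n).
Implicit Types (w : W) (i j : 'I_K).
Local Notation cnt := (counts R K nS r L sched tb n).
Local Notation A w t := (play R K nS r L sched tb n w t (cnt w t)).
Variables (P : forall i : 'I_K, 'M[R]_((nS i).+1)) (init pi : forall i, St i -> R).
Hypotheses (hP : forall i, stochastic (P i)) (hi : forall i, prob_vec (@init i)).
Local Notation Ex := (@Ex R K nS n P init).
Local Notation mui := (mu r pi).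

Lemma regret_le (M : nat) (m1 : R) (G : 'I_K -> R) : (M <= K)%N ->
  valid_sched M sched -> valid_tb M tb -> (forall j, mui j <= m1) ->
  (forall i, exists2 g : St i -> R,
    forall x : St i, g x - mact (P i) g x = r x - mui i & forall x, `|g x| <= G i) ->
  regret r L sched tb n P init pi M <=
    \sum_(i < K | (M <= i)%N) (m1 - mui i) * Ex (fun w => (cnt w n i)%:R) +
    \sum_i 2 * G i.
Proof.
move=> MK hs ht mu1 hG.
have totalE w : total_reward R K nS r L sched tb n w =
    \sum_i \sum_(t < n) (i \in A w t)%:R * (r (w i (inord (cnt w t i))) - mui i) +
    \sum_i mui i * (cnt w n i)%:R.
  rewrite /total_reward -big_split /=.
  under eq_bigr => t _ do rewrite /slot_reward big_mkcond /=.
  rewrite exchange_big /=; apply: eq_bigr => i _.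
  rewrite counts_sum natr_sum mulr_sumr -big_split /=; apply: eq_bigr => t _.
  by case: (i \in _); rewrite /= ?mul1r ?mul0r ?mulr1 ?mulr0 ?subrK ?addr0.
have leT w (j : 'I_K) : (cnt w n j)%:R <= n%:R :> R by rewrite ler_nat counts_le.
(* All counts add up to [n * M], so plays of suboptimal arms equal in number those missed by the
   optimal arms, and each missed play is worth at most [m1]. *)
have point w : n%:R * (\sum_(j < K | (j < M)%N) mui j) <=
    \sum_i mui i * (cnt w n i)%:R +
    \sum_(i < K | (M <= i)%N) (m1 - mui i) * (cnt w n i)%:R.
  have cntM : \sum_i (cnt w n i)%:R = n%:R * M%:R :> R.
    by rewrite -natr_sum (sum_counts _ _ _ _ hs ht) natrM.
  have cardM : \sum_(j < K | (j < M)%N) n%:R = n%:R * M%:R :> R.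
    by rewrite -(big_ord_widen K (fun=> n%:R)) // sumr_const card_ord mulr_natr.
  have split F : \sum_(i < K) F i = \sum_(i < K | (i < M)%N) F i +
      \sum_(i < K | (M <= i)%N) F i :> R.
    rewrite (bigID (fun i : 'I_K => (i < M)%N)) /=; congr (_ + _).
    by apply: eq_bigl => i; rewrite -leqNgt.
  rewrite (split (fun i => mui i * (cnt w n i)%:R)) -addrA -big_split /=.
  under [X in _ + X]eq_bigr do rewrite -mulrDl addrC subrK.
  rewrite -mulr_sumr.
  have -> : \sum_(i < K | (M <= i)%N) (cnt w n i)%:R =
      \sum_(j < K | (j < M)%N) (n%:R - (cnt w n j)%:R) :> R.
    by rewrite sumrB cardM -cntM (split (fun i => (cnt w n i)%:R)) addrC addKr.
  rewrite !mulr_sumr -big_split; apply: ler_sum => j _ /=.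
  have := mu1 j; have := leT w j; nra.
rewrite /regret.
have -> : expected_reward R K nS r L sched tb n P init =
  Ex (fun w => \sum_i \sum_(t < n) (i \in A w t)%:R *
        (r (w i (inord (cnt w t i))) - mui i)) +
    Ex (fun w => \sum_i mui i * (cnt w n i)%:R).
  by rewrite -ExD; apply: eq_bigr => w _; rewrite totalE.
have h1 : - \sum_i 2 * G i <= Ex (fun w => \sum_i \sum_(t < n) (i \in A w t)%:R *
        (r (w i (inord (cnt w t i))) - mui i)).
  rewrite Ex_sum -sumrN; apply: ler_sum => i _.
  by have [g hg gG] := hG i; apply: arm_reward_ge hg gG.
have := le_Ex hP hi point; rewrite Ex_cst // ExD.
have -> : Ex (fun w => \sum_(i < K | (M <= i)%N) (m1 - mui i) * (cnt w n i)%:R) =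
    \sum_(i < K | (M <= i)%N) (m1 - mui i) * Ex (fun w => (cnt w n i)%:R).
  by rewrite Ex_sum; apply: eq_bigr => i _; rewrite ExZ.
lra.
Qed.
End RegretBound.

(** * Bounds on the model constants *)

Section Constants.
Variables (R : realType) (K : nat) (nS : 'I_K -> nat).
Local Notation St i := ('I_(nS i).+1).
Variables (r pi : forall i : 'I_K, St i -> R).
Implicit Types (i j : 'I_K).

Lemma le_rmax i (x : St i) : r x <= rmax r.
Proof.
rewrite /rmax (bigmaxD1 i) // le_max; apply/orP; left.
by rewrite (bigmaxD1 x) // le_max lexx.
Qed.

Lemma le_pihat_max i (x : St i) : pi x <= pihat_max pi.
Proof.
rewrite /pihat_max (bigmaxD1 i) // le_max; apply/orP; left.
by rewrite (bigmaxD1 x) // !le_max lexx.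
Qed.

Hypothesis hpi : forall i, prob_vec (@pi i).

(** The stationary probabilities of one arm sum to 1, and each is at most [pihat_max]. This discards
    the factors of the condition on [L] other than [rmax] and the gap. *)
Lemma Smax_pihat_max_ge1 i : 1 <= Smax nS * pihat_max pi :> R.
Proof.
rewrite -(hpi i).2.
apply: (@le_trans _ _ ((nS i).+1%:R * pihat_max pi)).
  rewrite mulr_natl -[(nS i).+1 in leRHS]card_ord -sumr_const.
  by apply: ler_sum => x _; exact: le_pihat_max.
rewrite ler_wpM2r ?ler_nat //; last exact: (leq_bigmax i).
exact: le_trans ((hpi i).1 ord0) (le_pihat_max _).
Qed.

Hypothesis hr : forall i (x : St i), 0 < r x.

Lemma mu_ge0 i : 0 <= mu r pi i.
Proof. by apply: sumr_ge0 => x _; rewrite mulr_ge0 ?(ltW (hr _)) // (hpi i).1. Qed.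

Lemma mu_le_rmax i : mu r pi i <= rmax r.
Proof.
rewrite -[leRHS]mulr1 -(hpi i).2 mulr_sumr; apply: ler_sum => x _.
by rewrite ler_wpM2r ?(hpi i).1 // le_rmax.
Qed.

Lemma reward_deviation_le i (x : St i) : `|r x - mu r pi i| <= rmax r.
Proof.
rewrite ler_norml; have := le_rmax x; have := hr x.
by have := mu_ge0 i; have := mu_le_rmax i => *; apply/andP; split; lra.
Qed.
End Constants.

(** * Assembly of the bound, with a constant fixed before the horizon *)

Unset Implicit Arguments.
Theorem theorem1 (R : realType) (K : nat) (nS : 'I_K -> nat)
  (P : forall i : 'I_K, 'M[R]_((nS i).+1))
  (r : forall i : 'I_K, 'I_(nS i).+1 -> R)
  (pi : forall i : 'I_K, 'I_(nS i).+1 -> R)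
  (eps : 'I_K -> R)
  (hP : forall i, stochastic (P i))
  (hirr : forall i, irreducible (P i))
  (hap : forall i, aperiodic (P i))
  (hpi : forall i, stationary (P i) (pi i))
  (hr : forall i x, 0 < r i x)
  (hsym : forall i, irreducible (msym (P i) (pi i)))
  (heps : forall i, is_lambda2 (msym (P i) (pi i)) (1 - eps i)) :
  exists C : R,
  forall (M : nat) (hM : (0 < M)%N) (hMK : (M <= K)%N),
  (forall i j : 'I_K, (i <= j)%N -> mu r pi j <= mu r pi i) ->
  (forall j : 'I_K, j = M :> nat -> mu r pi j < mu r pi (armM hM hMK)) ->
  forall L : R,
  112 * Smax nS ^+ 2 * rmax r ^+ 2 * pihat_max pi ^+ 2 / fmin eps <= L ->
  forall (sched : nat -> {set 'I_K}) (tb : nat -> ('I_K -> R) -> {set 'I_K}),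
  valid_sched M sched -> valid_tb M tb ->
  forall init : forall i : 'I_K, 'I_(nS i).+1 -> R,
  (forall i, prob_vec (init i)) ->
  forall n : nat,
  regret r L sched tb n P init pi M <=
    4 * L * ln (n%:R) *
      (\sum_(i < K | (M <= i)%N)
         (mu r pi (arm1 hM hMK) - mu r pi i) /
         (mu r pi (armM hM hMK) - mu r pi i) ^+ 2)
    + (\sum_(i < K | (M <= i)%N)
         (mu r pi (arm1 hM hMK) - mu r pi i) *
         (M%:R + \sum_(j < K | (j < M)%N) Cij pi i j))
    + C.
Proof.
have pi0 i x : 0 < pi i x := stationary_gt0 (hP i) (hirr i) (hpi i) x.
have gaps i := msym_gap (hP i) (hpi i) (pi0 i) (hsym i) (heps i).
have e0 i : 0 < eps i by have [] := gaps i.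
have e1 i : eps i <= 1 by have [] := gaps i.
have gap i (h : 'I_(nS i).+1 -> R) : \sum_x pi i x * h x = 0 ->
    \sum_x pi i x * mact (P i) h x ^+ 2 <= (1 - eps i) * \sum_x pi i x * h x ^+ 2.
  by have [_ _] := gaps i; apply.
have pvec i : prob_vec (pi i) := (hpi i).1.
have hpoisson i : exists Gi : R, exists2 g : 'I_(nS i).+1 -> R,
    forall x, g x - mact (P i) g x = r i x - mu r pi i & forall x, `|g x| <= Gi.
  have [g hg] := poisson_equation (hpi i) (pi0 i) (e0 i) (@gap i)
    (mean_deviation r hpi i).
  exists (\sum_x `|g x|), g => // x.
  by rewrite (bigD1 x) //= lerDl sumr_ge0.
have [G hG] := choice hpoisson.
pose c : R := \sum_i \sum_x (pi i x)^-1.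
have hc i (x : 'I_(nS i).+1) : (pi i x)^-1 <= c.
  have inv0 j y : 0 <= (pi j y)^-1 by rewrite invr_ge0 ltW.
  rewrite /c (bigD1 i) //= (bigD1 x) //= -addrA lerDl addr_ge0 ?sumr_ge0 // => j _.
  exact: sumr_ge0.
pose c1 : R := 1 + K%:R + K.+1%:R * c * 2.
have c10 : 0 <= c1.
  rewrite !addr_ge0 // !mulr_ge0 // sumr_ge0 // => i _.
  by rewrite sumr_ge0 // => x _; rewrite invr_ge0 ltW.
(* Built from the arms alone: the Poisson boundary terms, plus at most [K] suboptimal arms, each
   with [c1] extra expected plays of cost at most [rmax r]. *)
exists (\sum_i 2 * G i + K%:R * (rmax r * c1)).
move=> M hM hMK mono sep L hL sched tb hs ht init hi n.
pose i0 := arm1 hM hMK; pose iM := armM hM hMK.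
have b0 : 0 < rmax r by apply: lt_le_trans (hr i0 ord0) (le_rmax _ _).
(* Concentration asks for [3 * 32 = 96], which 112 covers. *)
have hLe i : 3 * (32 * rmax r ^+ 2) <= L * eps i.
  have em0 : 0 < fmin eps := fmin_gt0 i0 e0.
  have Sp := Smax_pihat_max_ge1 pvec i0.
  have Sp2 : 1 <= (Smax nS * pihat_max pi) ^+ 2 by rewrite exprn_ege1.
  have L0 : 0 <= L.
    apply: le_trans hL; rewrite divr_ge0 ?(ltW em0) //.
    by do 3![apply: mulr_ge0; last exact: sqr_ge0].
  apply: (@le_trans _ _ (L * fmin eps)); last by rewrite ler_wpM2l // fmin_le.
  move: hL; rewrite ler_pdivrMr //; apply: le_trans.
  have : rmax r ^+ 2 * 1 <= rmax r ^+ 2 * (Smax nS * pihat_max pi) ^+ 2.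
    by rewrite ler_wpM2l // sqr_ge0.
  by have := sqr_ge0 (rmax r); rewrite exprMn; lra.
have mu1 j : mu r pi j <= mu r pi i0 by apply: mono.
have sepi (i : 'I_K) : (M <= i)%N -> mu r pi i < mu r pi iM.
  move=> Mi; have MK : (M < K)%N := leq_ltn_trans Mi (ltn_ord i).
  by apply: le_lt_trans (sep (Ordinal MK) erefl); apply: mono.
have hD (i j : 'I_K) : (j < M)%N -> mu r pi i + (mu r pi iM - mu r pi i) <= mu r pi j.
  by move=> jM; rewrite addrC subrK; apply: mono => /=; lia.
apply: le_trans (regret_le L n hP hi hMK hs ht mu1 hG) _.
have ET (i : 'I_K) : (M <= i)%N ->
    Ex P init (fun w => (counts R K nS r L sched tb n w n i)%:R) <=
    4 * L * ln n%:R / (mu r pi iM - mu r pi i) ^+ 2 + c1.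
  move=> Mi; have D0 : 0 < mu r pi iM - mu r pi i by rewrite subr_gt0 sepi.
  exact: (expected_counts_le n hP hi hpi pi0 e0 e1 gap b0
    (reward_deviation_le pvec hr) hc hLe hM hMK hs ht Mi D0 (hD i)).
have Cij0 i j : 0 <= Cij pi i j.
  rewrite /Cij divr_ge0 ?mulr_ge0 ?beta_ge0 //.
  by do 2![apply: fmin_ge0 => ?]; rewrite ltW.
have -> : 4 * L * ln n%:R * (\sum_(i < K | (M <= i)%N)
    (mu r pi i0 - mu r pi i) / (mu r pi iM - mu r pi i) ^+ 2) =
  \sum_(i < K | (M <= i)%N) (mu r pi i0 - mu r pi i) *
     (4 * L * ln n%:R / (mu r pi iM - mu r pi i) ^+ 2).
  by rewrite mulr_sumr; apply: eq_bigr => i _; rewrite mulrA mulrAC mulrC mulrA.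
rewrite [\sum_i 2 * G i + _]addrC addrA lerD2r.
(* The second sum of the bound is nonnegative, so it may be added on the right. *)
have slack : 0 <= \sum_(i < K | (M <= i)%N) (mu r pi i0 - mu r pi i) *
    (M%:R + \sum_(j < K | (j < M)%N) Cij pi i j).
  by apply: sumr_ge0 => i _; rewrite mulr_ge0 ?subr_ge0 // addr_ge0 // sumr_ge0.
have main : \sum_(i < K | (M <= i)%N) (mu r pi i0 - mu r pi i) *
      Ex P init (fun w => (counts R K nS r L sched tb n w n i)%:R) <=
    \sum_(i < K | (M <= i)%N) (mu r pi i0 - mu r pi i) *
     (4 * L * ln n%:R / (mu r pi iM - mu r pi i) ^+ 2) +
    \sum_(i < K | (M <= i)%N) (mu r pi i0 - mu r pi i) * c1.
  rewrite -big_split /=; apply: ler_sum => i Mi.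
  by rewrite -mulrDr ler_wpM2l ?subr_ge0 // ET.
have rest : \sum_(i < K | (M <= i)%N) (mu r pi i0 - mu r pi i) * c1 <=
    K%:R * (rmax r * c1).
  have -> : K%:R * (rmax r * c1) = \sum_(i < K) rmax r * c1.
    by rewrite sumr_const card_ord mulr_natl.
  rewrite big_mkcond /=; apply: ler_sum => i _; case: ifP => _; last first.
    by rewrite mulr_ge0 // ltW.
  rewrite ler_wpM2r //; have := mu_le_rmax r pvec i0; have := mu_ge0 pvec hr i.
  lra.
lra.
Qed.
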